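(* Consider the stochastic $N$-player Lipschitz continuous game and its randomized smoothed counterpart with parameter $\eta>0$. Suppose that each Clarke subdifferential $x_i\mapsto\partial^Ch_i(x_i)$ is $\hat L_i$-Lipschitz. If the output $x^R$ of the RS-RSG scheme satisfies $\mathbb{E}[\|G^\eta_{\gamma_R}(x^R)\|^2]\le\epsilon^2$, then $$\mathbb{E}\left[\mathrm{dist}(0,\mathbf{G}_{\gamma_R}(x^R))^2\right]\le2\eta^2\sum_{i=1}^N\hat L_i^2+2\epsilon^2,$$ where $\mathbf{G}_{\gamma_R}(x^R)=\frac1{\gamma_R}(x^R-\Pi_X[x^R-\gamma_R\mathbf{F}(x^R)])$ is set-valued, with $\mathbf{F}(x^R)=(\partial^Ch_i(x_i^R))_{i=1}^N+(\nabla_{x_i}m_i(x_i^R,x_{-i}^R))_{i=1}^N$.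
   Context: Lipschitz continuous game. $[N]=\{1,\dots,N\}$; each $X_i\subseteq\mathbb{R}^{n_i}$ is nonempty, closed and convex; $X=\prod_iX_i$; $x_{-i}=(x_j)_{j\neq i}$. Given $x_{-i}$, player $i$ solves $\min_{x_i\in X_i}f_i(x_i,x_{-i})=h_i(x_i)+m_i(x_i,x_{-i})$, $h_i(x_i)=\mathbb{E}[\tilde h_i(x_i,\xi)]$, $m_i(x_i,x_{-i})=\mathbb{E}[\tilde m_i(x_i,x_{-i},\xi)]$, with $\xi$ a random vector, $\tilde h_i(\cdot,\xi)$ $L_i$-Lipschitz continuous for every $\xi$ over $X_i$ (and on the points at distance at most $\eta$ from $X_i$ used by the smoothing), and $\tilde m_i(\cdot,x_{-i},\xi)$ continuously differentiable. The game is assumed to admit a potential function $P$, i.e. $P(x_i^1,x_{-i})-P(x_i^2,x_{-i})=f_i(x_i^1,x_{-i})-f_i(x_i^2,x_{-i})$ for all $i$, $x_i^1,x_i^2\in X_i$, $x_{-i}$. Randomized smoothed game. $\mathbb{B}_{n_i}$ and $\mathbb{S}_{n_i}$ are the closed unit ball and unit sphere of $\mathbb{R}^{n_i}$. $h_i^\eta(x_i)=\mathbb{E}_{u_i}[h_i(x_i+\eta u_i)]$, $u_i$ uniform on $\mathbb{B}_{n_i}$; player $i$ solves $\min_{x_i\in X_i}f_i^\eta(x_i,x_{-i})=h_i^\eta(x_i)+m_i(x_i,x_{-i})$. Residual: $G^\eta_\gamma(x)=\frac1\gamma(x-\Pi_X[x-\gamma F^\eta(x)])$, $F^\eta(x)=(\nabla_{x_i}f_i^\eta(x_i,x_{-i}))_{i=1}^N$,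 $\gamma>0$. Standing assumptions (Assumption C). The smoothed game admits a $C^1$ potential $P^\eta$ with $L^\eta$-Lipschitz gradient attaining its maximum and minimum over $X$; at every iterate $x^k$, $\nabla_{x_i}\tilde m_i(x^k,\xi)$ is conditionally unbiased for $\nabla_{x_i}m_i(x^k)$ with conditional second moment of the error at most $\sigma_m^2$. RS-RSG scheme. From $x^0\in X$, with stepsizes $\gamma_k>0$, batch sizes $S_k$, and $R$ random on $\{1,\dots,T\}$ with probability mass function $P_R$: for $k=0,\dots,R-1$ and each $i$, draw i.i.d. realizations $\xi_{i,l}^k$ of $\xi$ and $v_{i,l}^k$ uniform on $\eta\mathbb{S}_{n_i}$, $l=1,\dots,S_k$, and set $x_i^{k+1}=\Pi_{X_i}[x_i^k-\gamma_k\frac1{S_k}\sum_{l=1}^{S_k}(\Delta^{k,h}_{i,l}+\Delta^{k,m}_{i,l})]$ with $\Delta^{k,h}_{i,l}=\frac{n_i}{2\eta}(\tilde h_i(x_i^k+v_{i,l}^k,\xi_{i,l}^k)-\tilde h_i(x_i^k-v_{i,l}^k,\xi_{i,l}^k))\frac{v_{i,l}^k}{\|v_{i,l}^k\|}$, $\Delta^{k,m}_{i,l}=\nabla_{x_i}\tilde m_i(x_i^k,x_{-i}^k,\xi_{i,l}^k)$. The output is $x^R$. Notation. A set-valued map $\Phi:U\rightrightarrows\mathbb{R}^p$ is $\hat L$-Lipschitz on $U$ if $\Phi(x)\subseteq\Phi(y)+\hat L\|x-y\|\mathbb{B}$ for all $x,y\in U$ ($\mathbb{B}$ the closed unit ball);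 here it is applied to $\partial^Ch_i$ on $U=X_i+\eta\mathbb{B}_{n_i}$. $\mathrm{dist}(x,A)=\inf_{y\in A}\|y-x\|$; for a set $A$, $\Pi_X[A]=\{\Pi_X[a]:a\in A\}$, with $\Pi_X$ Euclidean projection. $\partial^C$ is the Clarke subdifferential. *)

(* Defs.v *)
From HB Require Import structures.
From mathcomp Require Import all_boot all_order all_algebra finmap.
From mathcomp Require Import all_classical all_reals all_analysis.
Set Implicit Arguments.
Unset Strict Implicit.
Unset Printing Implicit Defensive.
Import Order.TTheory GRing.Theory Num.Theory.
Import numFieldNormedType.Exports.
Local Open Scope classical_set_scope.
Local Open Scope ring_scope.

(* R^k is 'rV[R]_k. Its library norm `|_| is the sup norm, so the Euclidean   *)
(* norm is defined separately; both induce the same topology.                 *)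
Definition dot (R : realType) (k : nat) (u v : 'rV[R]_k) : R :=
  \sum_(j < k) u 0 j * v 0 j.

Definition enorm (R : realType) (k : nat) (v : 'rV[R]_k) : R :=
  Num.sqrt (\sum_(j < k) v 0 j ^+ 2).

Definition eball (R : realType) (k : nat) : set 'rV[R]_k :=
  [set u | enorm u <= 1].

Definition enlarge (R : realType) (k : nat) (A : set 'rV[R]_k) (r : R) :
    set 'rV[R]_k :=
  [set x + r *: u | x in A & u in @eball R k].

(* inf set0 = 0 in the library: meaningful for nonempty A only. *)
Definition eucl_dist (R : realType) (k : nat) (x : 'rV[R]_k) (A : set 'rV[R]_k) : R :=
  inf [set enorm (y - x) | y in A].

(* Euclidean projection: well defined when A is nonempty, closed and convex. *)
Definition eproj (R : realType) (k : nat) (A : set 'rV[R]_k) (x : 'rV[R]_k) :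
    'rV[R]_k :=
  get [set p | A p /\ forall y, A y -> enorm (x - p) <= enorm (x - y)].

Definition grad (R : realType) (k : nat) (g : 'rV[R]_k -> R) (x : 'rV[R]_k) :
    'rV[R]_k :=
  \row_j 'D_(delta_mx 0 j) g x.

Definition C1_on (R : realType) (k : nat) (A : set 'rV[R]_k)
    (g : 'rV[R]_k -> R) : Prop :=
  (forall x, A x -> differentiable g x) /\ {within A, continuous (grad g)}.

Definition elipschitz (R : realType) (k m : nat) (L : R) (A : set 'rV[R]_k)
    (g : 'rV[R]_k -> 'rV[R]_m) : Prop :=
  forall x y, A x -> A y -> enorm (g x - g y) <= L * enorm (x - y).

(* Clarke's generalized directional derivative,                               *)
(* limsup_{y -> x, t -> 0+} (g (y + t d) - g y) / t, and subdifferential.     *)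
Definition clarke_deriv (R : realType) (k : nat) (g : 'rV[R]_k -> R)
    (x d : 'rV[R]_k) : \bar R :=
  limf_esup
    (fun p : 'rV[R]_k * R => ((g (p.1 + p.2 *: d) - g p.1) / p.2)%:E)
    (filter_prod (nbhs x) (at_right (0 : R))).

Definition clarke (R : realType) (k : nat) (g : 'rV[R]_k -> R) (x : 'rV[R]_k) :
    set 'rV[R]_k :=
  [set v | forall d, ((dot v d)%:E <= clarke_deriv g x d)%E].

Definition set_lipschitz (R : realType) (k m : nat) (L : R) (A : set 'rV[R]_k)
    (Phi : 'rV[R]_k -> set 'rV[R]_m) : Prop :=
  forall x y, A x -> A y ->
    Phi x `<=` [set v + (L * enorm (x - y)) *: b | v in Phi y & b in @eball R m].

(* Borel sigma-algebra of R^k, generated by the coordinates (as the library   *)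
(* does for k.-tuple R).                                                      *)
Section measurable_rV.
Variables (R : realType) (k : nat).

Let coors : 'I_k -> 'rV[R]_k -> R := fun j v => v 0 j.

Let rV_set0 : g_sigma_preimage coors set0.
Proof. exact: sigma_algebra0. Qed.

Let rV_setC A : g_sigma_preimage coors A -> g_sigma_preimage coors (~` A).
Proof. exact: sigma_algebraC. Qed.

Let rV_bigcup (F : (set 'rV[R]_k)^nat) :
  (forall i, g_sigma_preimage coors (F i)) ->
  g_sigma_preimage coors (\bigcup_i (F i)).
Proof. exact: sigma_algebra_bigcup. Qed.

HB.instance Definition _ := @isMeasurable.Build default_measure_display
  'rV[R]_k (g_sigma_preimage coors) rV_set0 rV_setC rV_bigcup.

End measurable_rV.

(* Lebesgue measure on R^k, as an iterated product measure. *)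
Fixpoint lebesgue_rV (R : realType) (k : nat) : set 'rV[R]_k -> \bar R :=
  match k with
  | 0%N => dirac (0 : 'rV[R]_0)
  | k'.+1 => fun A =>
      (@lebesgue_measure R \x @lebesgue_rV R k')%E
        [set p : R * 'rV[R]_k' | A (row_mx p.1%:M p.2 : 'rV[R]_(1 + k'))]
  end.

(* Expectation of g u for u uniform on the closed unit ball of R^k. *)
Definition ball_mean (R : realType) (k : nat) (g : 'rV[R]_k -> R) : R :=
  fine (\int[@lebesgue_rV R k]_(u in @eball R k) (g u)%:E)%E
  / fine (lebesgue_rV (@eball R k)).

(* The uniform law on the sphere of radius r is the unique probability on it  *)
(* that is invariant under the orthogonal group.                              *)
Definition uniform_sphere (R : realType) (k : nat) (r : R)
    (mu : set 'rV[R]_k -> \bar R) : Prop :=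
  mu [set v | enorm v = r] = 1%E /\
  forall O : 'M[R]_k, O *m O^T = 1%:M -> forall A, measurable A ->
    mu [set v | A (v *m O)] = mu A.

Definition sigma_gen (d d' : measure_display) (Om : measurableType d)
    (T : measurableType d') (Z : Om -> T) : set (set Om) :=
  preimage_set_system setT Z measurable.

(* Mutual independence of the sub-sigma-algebras F i, i in D. *)
Definition mutual_indep (R : realType) (d : measure_display)
    (Om : measurableType d) (Pr : probability Om R) (I : choiceType)
    (D : set I) (F : I -> set (set Om)) : Prop :=
  forall J : {fset I}, [set` J] `<=` D ->
  forall E : I -> set Om, (forall i, i \in J -> F i (E i)) ->
    Pr (\bigcap_(i in [set` J]) E i) = (\prod_(i <- J) Pr (E i))%E.

(* Z is a version of E[Y | F], stated through Y - Z so that only the error,   *)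
(* and not Y and Z separately, has to be integrable.                          *)
Definition cond_unbiased (R : realType) (d : measure_display)
    (Om : measurableType d) (Pr : probability Om R) (F : set (set Om))
    (k : nat) (Y Z : Om -> 'rV[R]_k) : Prop :=
  sigma_gen Z `<=` F /\
  forall j : 'I_k, Pr.-integrable setT (fun w => (Y w 0 j - Z w 0 j)%:E) /\
    forall A, F A -> (\int[Pr]_(w in A) (Y w 0 j - Z w 0 j)%:E = 0)%E.

(* E[|Y - Z|^2 | F] <= s^2 almost surely. *)
Definition cond_moment2 (R : realType) (d : measure_display)
    (Om : measurableType d) (Pr : probability Om R) (F : set (set Om))
    (k : nat) (Y Z : Om -> 'rV[R]_k) (s : R) : Prop :=
  forall A, F A ->
    (\int[Pr]_(w in A) (enorm (Y w - Z w) ^+ 2)%:E <= (s ^+ 2)%:E * Pr A)%E.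

(* A profile x = (x_i)_i is the row of its blocks x_i = submxrow x i.         *)
(* Functions of (x_i, x_{-i}) are functions of the profile, and repl x i z is *)
(* the profile (z, x_{-i}).                                                   *)
Definition repl (R : realType) (N : nat) (n : 'I_N -> nat)
    (x : 'rV[R]_(\sum_i n i)) (i : 'I_N) (z : 'rV[R]_(n i)) :
    'rV[R]_(\sum_i n i) :=
  \mxrow_j @dfwith 'I_N (fun j => 'rV[R]_(n j)) (submxrow x) i z j.

Definition pgrad (R : realType) (N : nat) (n : 'I_N -> nat) (i : 'I_N)
    (g : 'rV[R]_(\sum_i n i) -> R) (x : 'rV[R]_(\sum_i n i)) : 'rV[R]_(n i) :=
  grad (fun z => g (repl x z)) (submxrow x i).

Definition is_potential (R : realType) (N : nat) (n : 'I_N -> nat)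
    (X : set 'rV[R]_(\sum_i n i)) (f : 'I_N -> 'rV[R]_(\sum_i n i) -> R)
    (P : 'rV[R]_(\sum_i n i) -> R) : Prop :=
  forall (i : 'I_N) (x : 'rV[R]_(\sum_i n i)) (z1 z2 : 'rV[R]_(n i)),
    X (repl x z1) -> X (repl x z2) ->
    P (repl x z1) - P (repl x z2) = f i (repl x z1) - f i (repl x z2).

(* Data of the game: hs i is h~_i and ms i is m~_i. *)
Record game (R : realType) (d : measure_display) (Om : measurableType d)
    (Pr : probability Om R) (N q : nat) (n : 'I_N -> nat) := Game {
  strat : forall i, set 'rV[R]_(n i) ;
  xi : {RV Pr >-> 'rV[R]_q} ;
  hs : forall i, 'rV[R]_(n i) -> 'rV[R]_q -> R ;
  ms : 'I_N -> 'rV[R]_(\sum_i n i) -> 'rV[R]_q -> R }.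

Arguments strat {R d Om Pr N q n} g i _.

Section game.
Context (R : realType) (d : measure_display) (Om : measurableType d)
  (Pr : probability Om R) (N q : nat) (n : 'I_N -> nat).
Variable G : game Pr q n.

Definition profiles : set 'rV[R]_(\sum_i n i) :=
  [set x | forall i, strat G i (submxrow x i)].

Definition hbar (i : 'I_N) (z : 'rV[R]_(n i)) : R :=
  fine 'E_Pr[fun w => hs G z (xi G w)].

Definition mbar (i : 'I_N) (x : 'rV[R]_(\sum_i n i)) : R :=
  fine 'E_Pr[fun w => ms G i x (xi G w)].

Definition cost (i : 'I_N) (x : 'rV[R]_(\sum_i n i)) : R :=
  hbar (submxrow x i) + mbar i x.

Definition h_eta (eta : R) (i : 'I_N) (z : 'rV[R]_(n i)) : R :=
  ball_mean (fun u => hbar (z + eta *: u)).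

Definition cost_eta (eta : R) (i : 'I_N) (x : 'rV[R]_(\sum_i n i)) : R :=
  h_eta eta (submxrow x i) + mbar i x.

Definition F_eta (eta : R) (x : 'rV[R]_(\sum_i n i)) : 'rV[R]_(\sum_i n i) :=
  \mxrow_i pgrad i (cost_eta eta i) x.

Definition G_eta (eta gamma : R) (x : 'rV[R]_(\sum_i n i)) :
    'rV[R]_(\sum_i n i) :=
  gamma^-1 *: (x - eproj profiles (x - gamma *: F_eta eta x)).

Definition F_clarke (x : 'rV[R]_(\sum_i n i)) : set 'rV[R]_(\sum_i n i) :=
  [set v | forall i, exists2 s, clarke (@hbar i) (submxrow x i) s &
                       submxrow v i = s + pgrad i (mbar i) x].

Definition G_clarke (gamma : R) (x : 'rV[R]_(\sum_i n i)) :
    set 'rV[R]_(\sum_i n i) :=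
  [set gamma^-1 *: (x - eproj profiles (x - gamma *: v)) | v in F_clarke x].

(* The measurability, integrability and m_differentiable fields are what the  *)
(* expectations h_i, m_i and the partial gradient of m_i need to be           *)
(* meaningful.                                                                *)
Record lipschitz_game (L : 'I_N -> R) (eta : R) : Prop := LipschitzGame {
  strat_nonempty : forall i, strat G i !=set0 ;
  strat_closed : forall i, closed (strat G i) ;
  strat_convex : forall i, convex_set (strat G i) ;
  hs_measurable : forall i z, enlarge (strat G i) eta z ->
    measurable_fun setT (hs G z) ;
  hs_integrable : forall i z, enlarge (strat G i) eta z ->
    Pr.-integrable setT (fun w => (hs G z (xi G w))%:E) ;
  hs_lipschitz : forall i (c : 'rV[R]_q) y z,
    enlarge (strat G i) eta y -> enlarge (strat G i) eta z ->
    `|hs G y c - hs G z c| <= L i * enorm (y - z) ;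
  ms_measurable : forall i x, profiles x -> measurable_fun setT (ms G i x) ;
  ms_integrable : forall i x, profiles x ->
    Pr.-integrable setT (fun w => (ms G i x (xi G w))%:E) ;
  ms_C1 : forall i (c : 'rV[R]_q) x, profiles x ->
    C1_on (strat G i) (fun z => ms G i (repl x z) c) ;
  m_differentiable : forall i x, profiles x ->
    differentiable (fun z : 'rV[R]_(n i) => mbar i (repl x z)) (submxrow x i) }.

Definition potential_game : Prop := exists P, is_potential profiles cost P.

Definition smoothed_potential_game (eta Leta : R) : Prop :=
  exists P, [/\ is_potential profiles (cost_eta eta) P,
                C1_on profiles P,
                elipschitz Leta profiles (grad P),
                (exists2 x, profiles x & forall y, profiles y -> P y <= P x) &
                (exists2 x, profiles x & forall y, profiles y -> P x <= P y)].

(* Random inputs and tuning constants of the scheme: samples xis k i l and    *)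
(* vs k i l at iteration k for player i, output index out.                    *)
Record scheme := Scheme {
  x0 : 'rV[R]_(\sum_i n i) ;
  horizon : nat ;
  step : nat -> R ;
  batch : nat -> nat ;
  xis : nat -> 'I_N -> nat -> {RV Pr >-> 'rV[R]_q} ;
  vs : nat -> forall i : 'I_N, nat -> {RV Pr >-> 'rV[R]_(n i)} ;
  out : {RV Pr >-> nat} }.

Variable A : scheme.

Definition Delta_h (eta : R) (i : 'I_N) (z v : 'rV[R]_(n i)) (c : 'rV[R]_q) :
    'rV[R]_(n i) :=
  ((n i)%:R / (2 * eta) * (hs G (z + v) c - hs G (z - v) c))
    *: ((enorm v)^-1 *: v).

Definition Delta_m (i : 'I_N) (x : 'rV[R]_(\sum_i n i)) (c : 'rV[R]_q) :
    'rV[R]_(n i) :=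
  pgrad i (fun y => ms G i y c) x.

Fixpoint iterate (eta : R) (k : nat) (w : Om) : 'rV[R]_(\sum_i n i) :=
  if k is k'.+1 then
    let x := iterate eta k' w in
    \mxrow_i eproj (strat G i)
      (submxrow x i - step A k' *: ((batch A k')%:R^-1 *:
        \sum_(l < batch A k')
          (Delta_h eta (submxrow x i) (vs A k' i l w) (xis A k' i l w)
           + Delta_m i x (xis A k' i l w))))
  else x0 A.

Definition output (eta : R) (w : Om) : 'rV[R]_(\sum_i n i) :=
  iterate eta (out A w) w.

Definition sample_index := (nat * 'I_N * nat)%type.

Definition sampled (a : sample_index) : Prop :=
  (a.1.1 < horizon A)%N /\ (a.2 < batch A a.1.1)%N.

Definition xis_at (a : sample_index) := xis A a.1.1 a.1.2 a.2.
Definition vs_at (a : sample_index) := vs A a.1.1 a.1.2 a.2.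

Definition input_index := (unit + (sample_index + sample_index))%type.

Definition input_used (a : input_index) : Prop :=
  match a with inl _ => True | inr (inl b) => sampled b | inr (inr b) => sampled b end.

Definition input_sigma (a : input_index) : set (set Om) :=
  match a with
  | inl _ => sigma_gen (out A)
  | inr (inl b) => sigma_gen (xis_at b)
  | inr (inr b) => sigma_gen (vs_at b)
  end.

(* Sigma-algebra generated by the samples drawn before iteration k, on which  *)
(* iterate eta k depends.                                                     *)
Definition history (k : nat) : set (set Om) :=
  <<s [set B | exists a, [/\ sampled a, (a.1.1 < k)%N &
         sigma_gen (xis_at a) B \/ sigma_gen (vs_at a) B]] >>.

Record rs_rsg (eta : R) (pR : nat -> R) : Prop := RSRSG {
  x0_in : profiles (x0 A) ;
  step_gt0 : forall k, (k <= horizon A)%N -> 0 < step A k ;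
  batch_gt0 : forall k, (k < horizon A)%N -> (0 < batch A k)%N ;
  out_range : forall w, (1 <= out A w <= horizon A)%N ;
  out_pmf : forall k, (1 <= k <= horizon A)%N ->
    Pr [set w | out A w = k] = (pR k)%:E ;
  xis_law : forall a, sampled a -> forall B, measurable B ->
    Pr (xis_at a @^-1` B) = Pr (xi G @^-1` B) ;
  vs_law : forall a, sampled a ->
    uniform_sphere eta (distribution Pr (vs_at a)) ;
  inputs_indep : mutual_indep Pr input_used input_sigma }.

Definition unbiased_sampling (eta sigma_m : R) : Prop :=
  forall a, sampled a -> let k := a.1.1 in let i := a.1.2 in
    let Y := fun w => Delta_m i (iterate eta k w) (xis_at a w) in
    let Z := fun w => pgrad i (mbar i) (iterate eta k w) in
    cond_unbiased Pr (history k) Y Z /\ cond_moment2 Pr (history k) Y Z sigma_m.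

End game.

Arguments hbar {R d Om Pr N q n} G i z.

(* Main.v *)
From HB Require Import structures.
Require Import Defs.
From mathcomp Require Import all_boot all_order all_algebra.
From mathcomp Require Import all_classical all_reals all_analysis.
From mathcomp Require Import measurable_realfun.
From mathcomp Require Import ring lra.
Set Implicit Arguments.
Unset Strict Implicit.
Unset Printing Implicit Defensive.
Import Order.TTheory GRing.Theory Num.Theory.
Import numFieldNormedType.Exports.
Local Open Scope classical_set_scope.
Local Open Scope ring_scope.

(** Idea. Write h for h_i and h^eta for its ball average. Near x, the increments
    of v |-> integral of h over x + v + eta B are additive up to an error that is
    small compared with |v|, because translating a ball only changes it inside a
    thin annulus; hence h^eta is differentiable in every
    direction at x, with a linear derivative.  By averaging, this derivative at d
    is at most the supremum of the Clarke directional derivatives h'(y; d) over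
    the ball around x of radius eta, and the Lipschitz assumption on the Clarke
    subdifferential bounds that by h'(x; d) + eta |L| |d|; so the gradient of
    h^eta lies within eta |L| of the Clarke subdifferential of h at x.  The
    theorem follows since projections are nonexpansive.

    The function h is arbitrary outside X_i + eta B.  The Lipschitz assumption
    at boundary points of X_i + eta B nevertheless makes the subdifferential
    there nonempty and bounded, which forces h to be Lipschitz near them. *)

(** * Euclidean norm and projections *)

(** Nothing here differentiates [h] itself: almost everywhere differentiability and the divergence
    theorem are replaced by an elementary fact, that a function of [t] bounded by C |t|, and
    additive near 0 up to arbitrarily small multiples of |t|, has a derivative at 0. Directional
    derivatives are enough because [grad] is made of them. Averaging compares difference quotients
    at one fixed [t], so a bound on Clarke derivatives helps only if it holds for the quotients at
    all base points of the closed ball at once. Compactness gives this uniformity, and also a single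
    Lipschitz constant valid slightly beyond the ball. To pass from directional bounds to a
    distance, only the direction g - s is tested, where [g] is the gradient and [s] the point of the
    subdifferential closest to it. The comparison of the two residuals is deterministic. No
    measurability of the residuals is established, so the expectations are compared as lower
    integrals. *)

Section euclid.
Context (R : realType).
Implicit Types (k : nat).

Lemma enormE k (v : 'rV[R]_k) : enorm v ^+ 2 = dot v v.
Proof.
rewrite /enorm sqr_sqrtr; last by apply: sumr_ge0 => j _; exact: sqr_ge0.
by apply: eq_bigr => j _; rewrite expr2.
Qed.

Lemma enorm_ge0 k (v : 'rV[R]_k) : 0 <= enorm v.
Proof. exact: sqrtr_ge0. Qed.

Lemma dotC k (u v : 'rV[R]_k) : dot u v = dot v u.
Proof. by apply: eq_bigr => j _; rewrite mulrC. Qed.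

Lemma dotDl k (u v w : 'rV[R]_k) : dot (u + v) w = dot u w + dot v w.
Proof. by rewrite -big_split; apply: eq_bigr => j _; rewrite mxE mulrDl. Qed.

Lemma dotDr k (u v w : 'rV[R]_k) : dot w (u + v) = dot w u + dot w v.
Proof. by rewrite dotC dotDl !(dotC w). Qed.

Lemma dotZl k a (u v : 'rV[R]_k) : dot (a *: u) v = a * dot u v.
Proof. by rewrite mulr_sumr; apply: eq_bigr => j _; rewrite mxE mulrA. Qed.

Lemma dotZr k a (u v : 'rV[R]_k) : dot u (a *: v) = a * dot u v.
Proof. by rewrite dotC dotZl dotC. Qed.

Lemma dotNl k (u v : 'rV[R]_k) : dot (- u) v = - dot u v.
Proof. by rewrite -scaleN1r dotZl mulN1r. Qed.

Lemma dotNr k (u v : 'rV[R]_k) : dot u (- v) = - dot u v.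
Proof. by rewrite dotC dotNl dotC. Qed.

Definition dotE := (dotDl, dotDr, dotNl, dotNr, dotZl, dotZr).

Lemma dot0l k (v : 'rV[R]_k) : dot 0 v = 0.
Proof. by rewrite -(scale0r 0) dotZl mul0r. Qed.

Lemma dot0r k (v : 'rV[R]_k) : dot v 0 = 0.
Proof. by rewrite dotC dot0l. Qed.

Lemma dot_delta k (v : 'rV[R]_k) j : dot v (delta_mx 0 j) = v 0 j.
Proof.
rewrite /dot (bigD1 j)//= mxE !eqxx mulr1 big1 ?addr0// => i /negPf ij.
by rewrite mxE ij andbF mulr0.
Qed.

Lemma dotvv_ge0 k (v : 'rV[R]_k) : 0 <= dot v v.
Proof. by rewrite -enormE sqr_ge0. Qed.

Lemma dotvv_eq0 k (v : 'rV[R]_k) : dot v v = 0 -> v = 0.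
Proof.
move=> /eqP; rewrite /dot psumr_eq0 => [/allP v0|j _]; last first.
  by rewrite -expr2 sqr_ge0.
apply/rowP => j; rewrite mxE; apply/eqP.
by have := v0 j (mem_index_enum _); rewrite /= mulf_eq0 orbb.
Qed.

Lemma dot_sqr_le k (u v : 'rV[R]_k) : dot u v ^+ 2 <= dot u u * dot v v.
Proof.
have [v0|v0] := eqVneq (dot v v) 0.
  by rewrite (dotvv_eq0 v0) !dot0r expr0n/= mulr0.
have vgt0 : 0 < dot v v by rewrite lt_def v0 dotvv_ge0.
have := dotvv_ge0 (dot v v *: u - dot u v *: v).
rewrite !dotE (dotC v u) => h.
have : 0 <= dot v v * (dot u u * dot v v - dot u v ^+ 2) by lra.
by rewrite pmulr_rge0// subr_ge0.
Qed.

Lemma dot_le k (u v : 'rV[R]_k) : dot u v <= enorm u * enorm v.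
Proof.
have [uv0|uv0] := leP (dot u v) 0.
  by apply: le_trans uv0 _; rewrite mulr_ge0 ?enorm_ge0.
rewrite -ler_sqr ?nnegrE ?mulr_ge0 ?enorm_ge0//; last exact: ltW.
by rewrite exprMn !enormE dot_sqr_le.
Qed.

Lemma enorm_sqr_le k (v : 'rV[R]_k) c : 0 <= c ->
  (enorm v <= c) = (dot v v <= c ^+ 2).
Proof. by move=> c0; rewrite -enormE ler_sqr ?nnegrE ?enorm_ge0. Qed.

Lemma enormZ k a (v : 'rV[R]_k) : enorm (a *: v) = `|a| * enorm v.
Proof.
apply/eqP; rewrite -(eqrXn2 (n := 2))// ?mulr_ge0 ?enorm_ge0//.
by rewrite exprMn !enormE !dotE real_normK ?num_real// mulrA expr2.
Qed.

Lemma enormN k (v : 'rV[R]_k) : enorm (- v) = enorm v.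
Proof. by rewrite -scaleN1r enormZ normrN normr1 mul1r. Qed.

Lemma enorm0 k : enorm (0 : 'rV[R]_k) = 0.
Proof. by rewrite -(scale0r 0) enormZ normr0 mul0r. Qed.

Lemma enorm_eq0 k (v : 'rV[R]_k) : enorm v = 0 -> v = 0.
Proof. by move=> v0; apply: dotvv_eq0; rewrite -enormE v0 expr0n. Qed.

Lemma enormD k (u v : 'rV[R]_k) : enorm (u + v) <= enorm u + enorm v.
Proof.
rewrite enorm_sqr_le ?addr_ge0 ?enorm_ge0// !dotE (dotC v u) sqrrD !enormE.
by have := dot_le u v; lra.
Qed.

Lemma enormB k (u v : 'rV[R]_k) : enorm (u - v) <= enorm u + enorm v.
Proof. by rewrite -(enormN v) enormD. Qed.

Lemma enorm_distC k (u v : 'rV[R]_k) : enorm (u - v) = enorm (v - u).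
Proof. by rewrite -enormN opprB. Qed.

Lemma enorm_distD k (w u v : 'rV[R]_k) :
  enorm (u - v) <= enorm (u - w) + enorm (w - v).
Proof. by rewrite -[u - v](subrKA w) enormD. Qed.

Lemma enorm_dist k (u v : 'rV[R]_k) : `|enorm u - enorm v| <= enorm (u - v).
Proof.
rewrite ler_norml; have := enormD (u - v) v; have := enormD (v - u) u.
by rewrite !subrK (enorm_distC v u); lra.
Qed.

Lemma coord_le_enorm k (v : 'rV[R]_k) j : `|v 0 j| <= enorm v.
Proof.
rewrite -ler_sqr ?nnegrE ?enorm_ge0// real_normK ?num_real// enormE /dot.
rewrite (bigD1 j)//= -expr2 lerDl; apply: sumr_ge0 => i _.
by rewrite -expr2 sqr_ge0.
Qed.

Lemma norm_coord k (v : 'rV[R]_k) j : `|v 0 j| <= `|v|.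
Proof.
by rewrite [leRHS]/Num.norm/= mx_normrE; apply/bigmax_geP; right; exists (0, j).
Qed.

Lemma norm_le_enorm k (v : 'rV[R]_k) : `|v| <= enorm v.
Proof.
rewrite [leLHS]/Num.norm/= mx_normrE; apply/bigmax_leP; split; first exact: enorm_ge0.
by move=> [i j] _ /=; rewrite ord1 coord_le_enorm.
Qed.

Lemma enorm_le_sum k (v : 'rV[R]_k) : enorm v <= \sum_j `|v 0 j|.
Proof.
rewrite {1}(row_sum_delta v); elim/big_ind2 : _ => [|x a y b xa yb|j _].
- by rewrite enorm0.
- by apply: le_trans (enormD _ _) _; exact: lerD.
- rewrite enormZ -[leRHS]mulr1; apply: ler_wpM2l => //.
  rewrite enorm_sqr_le// expr1n dot_delta mxE !eqxx; exact: lexx.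
Qed.

Lemma enorm_le_norm k (v : 'rV[R]_k) : enorm v <= k%:R * `|v|.
Proof.
apply: le_trans (enorm_le_sum v) _.
apply: le_trans (ler_sum _ (fun j _ => norm_coord v j)) _.
by rewrite sumr_const card_ord mulr_natl.
Qed.

Lemma lipschitz_continuous k (f : 'rV[R]_k -> R) M :
  (forall x y, `|f x - f y| <= M * enorm (x - y)) -> continuous f.
Proof.
move=> fM x; apply/(@cvgrPdist_le _ _ _ _ (nbhs_filter x)) => e e0.
pose M' := `|M| * k%:R + 1.
have M'0 : 0 < M' by rewrite ltr_wpDl// mulr_ge0.
near=> y; apply: le_trans (fM _ _) _.
have xy : `|x - y| <= e / M'.
  by near: y; apply: (@cvgr_dist_le _ _ _ (nbhs x) _ id x) => //; rewrite divr_gt0.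
apply: le_trans (ler_wpM2r (enorm_ge0 _) (ler_norm M)) _.
apply: le_trans (ler_wpM2l (normr_ge0 M) (enorm_le_norm _)) _.
have : M' * `|x - y| <= e by rewrite mulrC -ler_pdivlMr.
rewrite mulrA; apply: le_trans; apply: ler_wpM2r => //.
by rewrite lerDl.
Unshelve. all: by end_near. Qed.

Lemma continuous_enormB k (x : 'rV[R]_k) :
  continuous (fun y : 'rV[R]_k => enorm (y - x)).
Proof.
apply: (@lipschitz_continuous _ _ 1) => y z; rewrite mul1r.
by apply: le_trans (enorm_dist _ _) _; rewrite opprB addrA subrK.
Qed.

Lemma compact_eball k (A : set 'rV[R]_k) r : closed A ->
  (forall x, A x -> enorm x <= r) -> compact A.
Proof.
move=> cA Ar; apply: bounded_closed_compact => //.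
exists `|r|; split; first exact: num_real.
move=> M rM x Ax; apply: le_trans (norm_le_enorm x) _.
apply: le_trans (Ar _ Ax) _; apply: le_trans (ler_norm _) _; exact: ltW.
Qed.

Lemma convex_setP k (A : set 'rV[R]_k) : convex_set A ->
  forall x y t, A x -> A y -> 0 <= t <= 1 -> A (x + t *: (y - x)).
Proof.
move=> cA x y t Ax Ay t01.
have /andP[t0 t1] := t01.
have := cA y x (Itv01 t0 t1) (mem_set Ay) (mem_set Ax).
rewrite inE; congr A; rewrite /conv/= /unstable.onem.
by rewrite scalerBl scalerBr scale1r addrC addrAC addrA.
Qed.

Lemma exists_closest k (A : set 'rV[R]_k) x : A !=set0 -> closed A ->
  exists2 p, A p & forall y, A y -> enorm (x - p) <= enorm (x - y).
Proof.
move=> [a Aa] cA.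
have cd : continuous (fun y : 'rV[R]_k => enorm (x - y)).
  by under eq_fun do rewrite enorm_distC; exact: continuous_enormB.
pose K := A `&` [set y | enorm (x - y) <= enorm (x - a)].
have cK : compact K.
  apply: (@compact_eball _ _ (enorm x + enorm (x - a))).
    apply: closedI => //.
    by apply: (@preimage_closed _ _ _ [set t | t <= enorm (x - a)]).
  move=> y [_ /= ya]; have := enormB x (x - y); rewrite subKr; lra.
have [||p] := @compact_EVT_min _ R (fun y : 'rV[R]_k => enorm (x - y)) K _ cK.
- by exists a; split => /=.
- exact: continuous_subspaceT.
rewrite inE => -[Ap pa] pmin; exists p => // y Ay.
have [ya|/ltW ya] := leP (enorm (x - y)) (enorm (x - a)).
  by apply: pmin; rewrite inE.
exact: le_trans pa ya.
Qed.

Lemma min_along_ray_dot_le0 k (u v : 'rV[R]_k) :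
  (forall t, 0 <= t <= 1 -> enorm u <= enorm (u - t *: v)) -> dot u v <= 0.
Proof.
move=> umin; rewrite leNgt; apply/negP => d0.
have v0 := dotvv_ge0 v.
(* With this choice t <= 1 and t |v|^2 = (1 - t) <u, v> < 2 <u, v>, so moving by [t] shortens [u];
   [v] need not be known to be nonzero. *)
pose t := dot u v / (dot v v + dot u v).
have s0 : 0 < dot v v + dot u v by rewrite ltr_wpDl.
have t0 : 0 < t by rewrite divr_gt0.
have t1 : t <= 1 by rewrite ler_pdivrMr// mul1r lerDr.
have := umin t; rewrite (ltW t0) t1 => /(_ isT).
rewrite enorm_sqr_le ?enorm_ge0// enormE !dotE (dotC v u).
have ts : t * (dot v v + dot u v) = dot u v by rewrite divfK// gt_eqF.
have : t * (t * dot v v) = t * (dot u v - t * dot u v).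
  by congr (_ * _); rewrite -{1}ts; ring.
have := mulr_gt0 t0 d0; have := mulr_gt0 t0 (mulr_gt0 t0 d0).
rewrite mulrBr; lra.
Qed.

(** Only segments issued from [p] are required to stay in [A], so the lemma serves projections onto
    strategy sets as well as the closest point of a Clarke subdifferential. *)
Lemma closest_obtuse k (A : set 'rV[R]_k) x p :
  (forall y t, A y -> 0 <= t <= 1 -> A (p + t *: (y - p))) ->
  (forall y, A y -> enorm (x - p) <= enorm (x - y)) ->
  forall y, A y -> dot (x - p) (y - p) <= 0.
Proof.
move=> cA pmin y Ay; apply: min_along_ray_dot_le0 => t t01.
by rewrite -addrA -opprD; apply: pmin; exact: cA.
Qed.

Section eproj.
Context k (A : set 'rV[R]_k).
Hypotheses (A0 : A !=set0) (cA : closed A) (vA : convex_set A).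

Let eprojP x : A (eproj A x) /\
  forall y, A y -> enorm (x - eproj A x) <= enorm (x - y).
Proof.
have [p Ap pmin] := exists_closest x A0 cA.
apply: (@getPex _ [set p | A p /\ forall y, A y -> enorm (x - p) <= enorm (x - y)]).
by exists p.
Qed.

Lemma eproj_in x : A (eproj A x).
Proof. by have [] := eprojP x. Qed.

(** Adding the obtuse-angle inequalities at the two projections p and q gives |p - q|^2 <= <x - y, p
    - q>; Cauchy-Schwarz concludes. *)
Lemma eproj_nonexpansive x y :
  enorm (eproj A x - eproj A y) <= enorm (x - y).
Proof.
have [Ax xmin] := eprojP x; have [Ay ymin] := eprojP y.
have vAp p t z : A p -> A z -> 0 <= t <= 1 -> A (p + t *: (z - p)).
  by move=> *; exact: convex_setP.
have := closest_obtuse (fun z t => @vAp _ t z Ax) xmin Ay.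
have := closest_obtuse (fun z t => @vAp _ t z Ay) ymin Ax.
set p := eproj A x; set q := eproj A y => h1 h2.
have : dot (p - q) (p - q) <= dot (x - y) (p - q).
  have -> : dot (p - q) (p - q) =
      dot (x - y) (p - q) + dot (x - p) (q - p) + dot (y - q) (p - q).
    rewrite -[q - p]opprB dotNr -dotNl -!dotDl; congr dot.
    by apply/rowP => j; rewrite !mxE; ring.
  by rewrite -[leRHS]addr0 -addrA lerD2l -[leRHS]addr0; exact: lerD h2 h1.
rewrite -enormE => /le_trans/(_ (dot_le _ _)).
have [->|pq0] := eqVneq (enorm (p - q)) 0; first by rewrite enorm_ge0.
by rewrite expr2 ler_pM2r// lt_def pq0 enorm_ge0.
Qed.

End eproj.
End euclid.

(** * Clarke subdifferential *)

Section sublinear.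
Context (R : realType) (k : nat).
Implicit Types (p q : 'rV[R]_k -> R) (u v d e : 'rV[R]_k).

Definition sublinear p := (forall u v, p (u + v) <= p u + p v) /\
  (forall (c : R) u, 0 < c -> p (c *: u) = c * p u).

Lemma sublinear0 p : sublinear p -> p 0 = 0.
Proof. by move=> [_ pZ]; have := pZ 2 0 (ltr0Sn _ _); rewrite scaler0; lra. Qed.

Lemma sublinearN_ge p u : sublinear p -> - p (- u) <= p u.
Proof.
by move=> sp; have := sp.1 u (- u); rewrite subrr sublinear0//; lra.
Qed.

(** Common source of three sublinear functions below: the Hahn-Banach step, the distance to a cone
    and Clarke's directional derivative. The minorant [lo] keeps every infimum meaningful. *)
Lemma inf_sublinear (F : 'rV[R]_k -> set R) (lo : 'rV[R]_k -> R) :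
  (forall u, F u !=set0) -> (forall u r, F u r -> lo u <= r) ->
  (forall u v r s, F u r -> F v s -> F (u + v) (r + s)) ->
  (forall (c : R) u r, 0 < c -> F u r -> F (c *: u) (c * r)) ->
  sublinear (fun u => inf (F u)).
Proof.
move=> F0 Flo FD FZ.
have Fle u r : F u r -> inf (F u) <= r.
  by move=> Fr; apply: ge_inf => //; exists (lo u) => s; exact: Flo.
have Fge u b : (forall r, F u r -> b <= r) -> b <= inf (F u).
  by move=> h; apply: lb_le_inf.
have FZle (c : R) u : 0 < c -> inf (F (c *: u)) <= c * inf (F u).
  move=> c0; rewrite mulrC -ler_pdivrMr//; apply: (Fge) => r Fr.
  by rewrite ler_pdivrMr// mulrC; exact/Fle/FZ.
split=> [u v|c u c0].
  rewrite -lerBlDr; apply: (Fge) => r Fr; rewrite lerBlDr -lerBlDl.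
  by apply: Fge => s Fs; rewrite lerBlDl; exact/Fle/FD.
apply/eqP; rewrite eq_le FZle//= -ler_pdivlMl//.
have := @FZle c^-1 (c *: u); rewrite scalerA mulVf ?gt_eqF// scale1r.
by apply; rewrite invr_gt0.
Qed.

(** The witness is q(u) = inf over t >= 0 of p(u + t e) - t p(e), the largest sublinear minorant of
    [p] with q(- e) <= - p(e). It is linear along [e], with q(e) = p(e). *)
Let extend_along p e : sublinear p ->
  exists2 q, sublinear q & (forall u, q u <= p u) /\ q (- e) <= - p e.
Proof.
move=> sp; have [pD pZ] := sp; have p0 := sublinear0 sp.
pose F u := [set r : R | exists2 t : R, 0 <= t & p (u + t *: e) - t * p e <= r].
have pte (t : R) : 0 <= t -> p (t *: e) = t * p e.
  rewrite le_eqVlt => /predU1P[<-|]; last exact: pZ.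
  by rewrite scale0r mul0r.
have Flo u r : F u r -> - p (- u) <= r.
  move=> [t t0]; apply: le_trans; rewrite -(pte t t0).
  by have := pD (u + t *: e) (- u); rewrite addrAC subrr add0r; lra.
have Fle u r : F u r -> inf (F u) <= r.
  by move=> Fr; apply: ge_inf => //; exists (- p (- u)) => s; exact: Flo.
exists (fun u => inf (F u)).
  apply: (inf_sublinear (lo := fun u => - p (- u))) => //.
  - by move=> u; exists (p u), 0 => //; rewrite scale0r addr0 mul0r subr0.
  - move=> u v r s [t t0 rt] [t' t'0 st]; exists (t + t'); first exact: addr_ge0.
    have := pD (u + t *: e) (v + t' *: e).
    by rewrite addrACA -scalerDl; lra.
  - move=> c u r c0 [t t0 rt]; exists (c * t).
      by rewrite mulr_ge0// ltW.
    rewrite -scalerA -scalerDr pZ// -mulrA -mulrBr.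
    by apply: ler_wpM2l => //; exact: ltW.
split=> [u|]; apply: Fle.
  by exists 0 => //; rewrite scale0r addr0 mul0r subr0.
by exists 1 => //; rewrite scale1r addNr p0 mul1r sub0r.
Qed.

Let extend_along_seq (s : seq 'rV[R]_k) p : sublinear p ->
  exists2 q, sublinear q & (forall u, q u <= p u) /\
    forall e, e \in s -> q (- e) <= - q e.
Proof.
elim: s p => [|e s IH] p sp; first by exists p.
have [q sq [qp qe]] := extend_along e sp; have [r sr [rq rs]] := IH q sq.
exists r => //; split=> [u|u]; first exact: le_trans (rq u) (qp u).
rewrite inE => /predU1P[->|]; last exact: rs.
have := rq (- e); have := rq e; have := qp e; lra.
Qed.

(* Hahn-Banach, by successively making p linear along the basis vectors. *)
Lemma sublinear_support p e : sublinear p ->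
  exists2 v, forall d, dot v d <= p d & p e <= dot v e.
Proof.
(* Starting with [e] itself fixes the value there: each later minorant r still satisfies r(- e) <= -
   p(e), hence r(e) >= p(e). *)
move=> sp; have [q sq [qp qe]] := extend_along e sp.
have [r sr [rq rs]] := extend_along_seq
  [seq delta_mx 0 j | j <- enum 'I_k] sq.
have rN j : r (- delta_mx 0 j) <= - r (delta_mx 0 j).
  by apply: rs; apply: map_f; rewrite mem_enum.
have r0 := sublinear0 sr.
pose v : 'rV[R]_k := \row_j r (delta_mx 0 j).
(* This inequality is an equality: applied to - d, with - r(- d) <= r(d), it also gives dot v d <=
   r(d). *)
have rv d : r d <= dot v d.
  rewrite {1}(row_sum_delta d) /dot.
  elim/big_rec2 : _ => [|j a b _ ba]; first by rewrite r0.
  apply: le_trans (sr.1 _ _) _; apply: lerD ba; rewrite mxE.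
  have [d0|d0|->] := ltgtP (d 0 j) 0.
  - rewrite -[d 0 j]opprK scaleNr -scalerN sr.2 ?oppr_gt0//.
    rewrite mulrN mulrC -mulrN -subr_ge0.
    have : 0 <= - d 0 j * (- r (delta_mx 0 j) - r (- delta_mx 0 j)).
      by apply: mulr_ge0; [rewrite oppr_ge0 ltW|rewrite subr_ge0 rN].
    lra.
  - by rewrite sr.2// mulrC.
  - by rewrite scale0r mulr0 r0.
exists v => [d|].
  apply: le_trans (qp d); apply: le_trans (rq d).
  have := rv (- d); have := sublinearN_ge d sr; rewrite dotNr; lra.
have := rv (- e); rewrite dotNr; have := rq (- e).
have := sublinearN_ge (- e) sr.
have := rv e; have := sublinearN_ge e sr; lra.
Qed.

End sublinear.

(** * Separation of a point from a convex cone that need not be closed *)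

Section cone.
Context (R : realType) (k : nat).
Implicit Types (C : set 'rV[R]_k).

(* Merge points of C on both sides of a coordinate hyperplane, one coordinate
   at a time. *)
Lemma convex_meets_orthants_0 C :
  (forall a b (t : R), C a -> C b -> 0 <= t <= 1 -> C (a + t *: (b - a))) ->
  (forall s : 'I_k -> bool, exists2 a, C a &
     forall j, 0 < (-1) ^+ s j * a 0 j) -> C 0.
Proof.
move=> cC hC.
have main (m : nat) : (m <= k)%N -> forall s : 'I_k -> bool, exists2 a, C a &
    forall j : 'I_k, if (j < m)%N then a 0 j = 0 else 0 < (-1) ^+ s j * a 0 j.
  elim: m => [_ s|m IH mk s]; first by have [a Ca sa] := hC s; exists a.
  pose jm := Ordinal mk.
  have [a1 Ca1 h1] := IH (ltnW mk) (fun j => if j == jm then false else s j).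
  have [a2 Ca2 h2] := IH (ltnW mk) (fun j => if j == jm then true else s j).
  have := h1 jm; rewrite eqxx /= ltnn expr0 mul1r => p1.
  have := h2 jm; rewrite eqxx /= ltnn expr1 mulN1r oppr_gt0 => p2.
  pose D := a1 0 jm - a2 0 jm.
  have D0 : 0 < D by rewrite /D; lra.
  pose t := a1 0 jm / D.
  have t0 : 0 < t by rewrite divr_gt0.
  have t1 : t < 1 by rewrite ltr_pdivrMr// /D; lra.
  exists (a1 + t *: (a2 - a1)); first by apply: cC => //; rewrite !ltW.
  move=> j; rewrite !mxE ltnS leq_eqVlt.
  have [->|jn] := eqVneq j jm.
    rewrite eqxx/= -[a2 0 jm - a1 0 jm]opprB -/D mulrN divfK ?gt_eqF//.
    by rewrite subrr.
  have /negPf -> : nat_of_ord j != m by apply: contra_neq jn => jm'; exact/val_inj.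
  have := h1 j; have := h2 j; rewrite (negPf jn)/=; case: ltnP => _.
    by move=> -> ->; rewrite subrr mulr0 addr0.
  move=> q2 q1.
  have -> : (-1) ^+ s j * (a1 0 j + t * (a2 0 j - a1 0 j)) =
    (1 - t) * ((-1) ^+ s j * a1 0 j) + t * ((-1) ^+ s j * a2 0 j) by ring.
  by rewrite addr_gt0// mulr_gt0// subr_gt0.
have [a Ca ha] := main k (leqnn k) (fun=> false).
rewrite (_ : 0 = a)//; apply/rowP => j.
by have := ha j; rewrite ltn_ord mxE.
Qed.

(** As [e] may lie in the closure of [C], its own distance to [C] is of no use. Some open orthant
    with apex [e] misses [C], otherwise [e] would be in [C] by convexity. The point [z] = [e] plus
    the sign vector of that orthant is then at distance at least 1 from [C]. The distance to [C] is
    sublinear, vanishes on [C] and is positive at [z]: its supporting form at [z] separates. *)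
Lemma cone_separation C e : C 0 -> (forall a b, C a -> C b -> C (a + b)) ->
  (forall (c : R) a, 0 < c -> C a -> C (c *: a)) -> ~ C e ->
  exists2 w, w != 0 & forall a, C a -> dot w a <= 0.
Proof.
move=> C0 CD CZ nCe.
have [s hs] : exists s : 'I_k -> bool, forall a, C a ->
    exists j, (-1) ^+ s j * (a 0 j - e 0 j) <= 0.
  apply: contrapT => /forallNP h; apply: nCe.
  rewrite -[e]add0r; apply: (@convex_meets_orthants_0 [set a | C (a + e)]).
    move=> a b t /= Ca Cb /andP[t0 t1].
    have [->|t0'] := eqVneq t 0; first by rewrite scale0r addr0.
    have [->|t1'] := eqVneq t 1; first by rewrite scale1r [a + _]addrC subrK.
    have -> : a + t *: (b - a) + e = (1 - t) *: (a + e) + t *: (b + e).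
      by apply/rowP => j; rewrite !mxE; ring.
    by apply: CD; apply: CZ => //; rewrite ?subr_gt0 lt_def ?t0' ?t0// eq_sym t1' t1.
  move=> s; have /existsNP[a /not_implyP[Ca /forallNP ha]] := h s.
  exists (a - e) => [|j]; first by rewrite /= subrK.
  by have /negP := ha j; rewrite -ltNge !mxE.
pose z := e + \row_j (-1) ^+ s j.
have za a : C a -> 1 <= enorm (z - a).
  move=> Ca; have [j hj] := hs a Ca.
  apply: le_trans (coord_le_enorm (z - a) j); rewrite !mxE.
  by move: hj; case: (s j); rewrite ?expr0 ?expr1 ler_normr; lra.
pose F u := [set r : R | exists2 a, C a & enorm (u - a) <= r].
have Flo u r : F u r -> 0 <= r by move=> [a _]; apply: le_trans; exact: enorm_ge0.
have sF : sublinear (fun u => inf (F u)).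
  apply: (inf_sublinear (lo := fun=> 0)) => //.
  - by move=> u; exists (enorm u), 0 => //; rewrite subr0.
  - move=> u v r t [a Ca ra] [b Cb rb]; exists (a + b); first exact: CD.
    by rewrite opprD addrACA; apply: le_trans (enormD _ _) _; exact: lerD.
  - move=> c u r c0 [a Ca ra]; exists (c *: a); first exact: CZ.
    by rewrite -scalerBr enormZ (gtr0_norm c0) ler_pM2l.
have [w wF wz] := sublinear_support z sF.
exists w => [|a Ca].
  apply/eqP => w0; move: wz; rewrite w0 dot0l; apply/negP; rewrite -ltNge.
  apply: (lt_le_trans ltr01).
  apply: lb_le_inf; first by exists (enorm z), 0 => //; rewrite subr0.
  by move=> r [a Ca]; apply: le_trans; exact: za.
apply: le_trans (wF a) _; apply: ge_inf; first by exists 0 => r; exact: Flo.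
by exists a => //; rewrite subrr enorm0.
Qed.

End cone.

(** * Clarke derivatives, their finiteness, and local Lipschitz continuity *)

Section clarke.
Context (R : realType) (k : nat).
Implicit Types (g : 'rV[R]_k -> R) (x y z d u v : 'rV[R]_k).

(** The real upper bounds of [clarke_deriv], which is an extended real and may be infinite. Working
    with these bounds keeps the calculus in [R]. *)
Definition clarke_le g x d (c : R) := forall c' : R, c < c' ->
  exists2 dl : R, 0 < dl & forall y (t : R), enorm (y - x) < dl -> 0 < t -> t < dl ->
    g (y + t *: d) - g y <= c' * t.

Lemma clarke_deriv_le g x d (c : R) :
  (clarke_deriv g x d <= c%:E)%E <-> clarke_le g x d c.
Proof.
rewrite /clarke_deriv limf_esupE; split=> [h c' cc'|h].
  have : (c%:E < c'%:E)%E by rewrite lte_fin.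
  move=> /(le_lt_trans h)/ereal_inf_lt[_ [V [[Q1 Q2] [xQ1 Q2p] QV] <-]] supV.
  move: xQ1 => /nbhs_ballP[d1/= d10 h1].
  move: Q2p => /nbhs_ballP[d2/= d20 h2].
  exists (Num.min d1 d2); first by rewrite lt_min d10.
  move=> y t; rewrite lt_min => /andP[yd1 _] t0; rewrite lt_min => /andP[_ td2].
  rewrite -ler_pdivrMr// -lee_fin; apply: ltW; apply: le_lt_trans supV.
  apply: ereal_sup_ubound; exists (y, t) => //; apply: QV; split=> /=.
    apply: h1; rewrite -ball_normE /= distrC.
    exact: le_lt_trans (norm_le_enorm _) yd1.
  by apply: h2 => //; rewrite -ball_normE /= sub0r normrN gtr0_norm.
apply/lee_addgt0Pr => e e0.
have [|dl dl0 hd] := h (c + e); first by rewrite ltrDl.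
pose V : set ('rV[R]_k * R) := [set p | enorm (p.1 - x) < dl /\ 0 < p.2 < dl].
apply: (@le_trans _ _ (ereal_sup [set ((g (p.1 + p.2 *: d) - g p.1) / p.2)%:E | p in V])).
  apply: ereal_inf_lbound; exists V => //.
  exists ([set y | enorm (y - x) < dl], [set t | 0 < t < dl]); last by [].
  split => /=.
    have /cvgr_lt := @continuous_enormB _ _ x x; rewrite subrr enorm0 => /(_ _ dl0); exact.
  near=> t; apply/andP; split.
    by near: t; exact: nbhs_right_gt.
  by near: t; exact: nbhs_right_lt.
apply: ge_ereal_sup => _ [[y t] /= [yx /andP[t0 td]] <-].
by rewrite -EFinD lee_fin ler_pdivrMr//; exact: hd.
Unshelve. all: by end_near. Qed.

(** Real bounds suffice: a derivative +oo constrains nothing, and -oo cannot occur, since then dot v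
    d - 1 would itself be an upper bound. *)
Lemma clarkeP g x v :
  clarke g x v <-> forall d c, clarke_le g x d c -> dot v d <= c.
Proof.
split=> [gv d c /clarke_deriv_le dc|h d].
  by rewrite -lee_fin; apply: le_trans (gv d) dc.
case E : (clarke_deriv g x d) => [r| |]; last 1 first.
- have := h d (dot v d - 1); rewrite -clarke_deriv_le E leNye => /(_ isT) h1.
  by exfalso; clear E; lra.
- by rewrite lee_fin; apply: h; rewrite -clarke_deriv_le E.
- by rewrite leey.
Qed.

Lemma clarke_leW g x d (c c' : R) : c <= c' -> clarke_le g x d c -> clarke_le g x d c'.
Proof. by move=> cc' h e /(le_lt_trans cc'); exact: h. Qed.

(** Go from y to y + t e, then to y + t e + t d. The second move starts from a displaced base point,
    which the definition allows; the radius d1 / (|e| + 1) keeps that point within d1 of [x]. *)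
Lemma clarke_leD g x d e (c c' : R) :
  clarke_le g x d c -> clarke_le g x e c' -> clarke_le g x (d + e) (c + c').
Proof.
move=> h h' b cb.
pose r := (b - (c + c')) / 2.
have r0 : 0 < r by rewrite divr_gt0// subr_gt0.
have [|d1 d10 h1] := h (c + r); first by rewrite ltrDl.
have [|d2 d20 h2] := h' (c' + r); first by rewrite ltrDl.
have N0 : 0 < enorm e + 1 by rewrite ltr_wpDl ?enorm_ge0.
exists (Num.min (d1 / (enorm e + 1)) (Num.min d1 d2)).
  by rewrite !lt_min d10 d20 divr_gt0.
move=> y t; rewrite !lt_min => /and3P[y1 yd1 yd2] t0 /and3P[t1 td1 td2].
have a2 := h2 y t yd2 t0 td2.
have a1 : g (y + t *: e + t *: d) - g (y + t *: e) <= (c + r) * t.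
  apply: h1 => //; rewrite addrAC; apply: le_lt_trans (enormD _ _) _.
  rewrite enormZ gtr0_norm//; rewrite ltr_pdivlMr// in y1; rewrite ltr_pdivlMr// in t1.
  have e0 := enorm_ge0 e.
  have : enorm e * (t * (enorm e + 1)) <= enorm e * d1 by rewrite ler_wpM2l// ltW.
  rewrite -(ltr_pM2r N0) => h3; lra.
have -> : b * t = (c + r) * t + (c' + r) * t by rewrite /r; field.
by rewrite scalerDr [t *: d + _]addrC addrA; lra.
Qed.

Lemma clarke_leZ g x d (a c : R) : 0 < a ->
  clarke_le g x d c -> clarke_le g x (a *: d) (a * c).
Proof.
move=> a0 h b cb; have [|dl dl0 hd] := h (b / a).
  by rewrite ltr_pdivlMr// mulrC.
have N0 : 0 < a + 1 by rewrite addr_gt0.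
exists (dl / (a + 1)); first by rewrite divr_gt0.
move=> y t; rewrite !ltr_pdivlMr// => yd t0 td.
have -> : b * t = b / a * (t * a) by field; rewrite gt_eqF.
rewrite scalerA; apply: hd; last 1 first.
- by apply: le_lt_trans td; rewrite ler_pM2l// lerDl.
- by apply: le_lt_trans yd; rewrite ler_peMr ?enorm_ge0// lerDr ltW.
- by rewrite mulr_gt0.
Qed.

Lemma clarke_le0 g x : clarke_le g x 0 0.
Proof.
move=> c c0; exists 1 => // y t _ t0 _.
by rewrite scaler0 addr0 subrr mulr_ge0 ?ltW.
Qed.

Definition lipschitz_near g x := exists M, exists2 dl : R, 0 < dl &
  forall y z, enorm (y - x) < dl -> enorm (z - x) < dl ->
    `|g y - g z| <= M * enorm (y - z).

(** The second half bounds the set of upper bounds from below, so that its infimum is the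
    directional derivative. *)
Lemma lipschitz_clarke_le g x (M dl : R) : 0 < dl -> 
  (forall y z, enorm (y - x) < dl -> enorm (z - x) < dl ->
    `|g y - g z| <= M * enorm (y - z)) ->
  forall d, clarke_le g x d (M * enorm d) /\
    forall c, clarke_le g x d c -> - (M * enorm d) <= c.
Proof.
move=> dl0 h d.
have N0 : 0 < enorm d + 1 by rewrite ltr_wpDl ?enorm_ge0.
pose r := dl / 2 / (enorm d + 1).
have r0 : 0 < r by rewrite !divr_gt0.
have key y (t : R) : enorm (y - x) < dl / 2 -> 0 < t -> t < r ->
    `|g (y + t *: d) - g y| <= M * enorm d * t.
  move=> yx t0 tr.
  have td : t * enorm d < dl / 2.
    rewrite /r ltr_pdivlMr// in tr; apply: le_lt_trans tr.
    by rewrite ler_pM2l// lerDl.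
  apply: le_trans (h _ _ _ _) _.
  - rewrite addrAC; apply: le_lt_trans (enormD _ _) _.
    rewrite enormZ gtr0_norm//; lra.
  - lra.
  - by rewrite addrAC subrr add0r enormZ gtr0_norm// mulrCA mulrC.
split=> [c Mc|c hc].
  exists (Num.min r (dl / 2)); first by rewrite lt_min r0 divr_gt0.
  move=> y t; rewrite !lt_min => /andP[_ yx] t0 /andP[tr _].
  apply: le_trans (ler_norm _) _; apply: le_trans (key y t yx t0 tr) _.
  by rewrite ler_pM2r// ltW.
apply/ler_addgt0Pr => e e0.
have [|d1 d10 h1] := hc (c + e); first by rewrite ltrDl.
pose t := Num.min r d1 / 2.
have m0 : 0 < Num.min r d1 by rewrite lt_min r0.
have t0 : 0 < t by rewrite divr_gt0.
have : t < Num.min r d1 by rewrite /t; lra.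
rewrite lt_min => /andP[tr td1].
have := h1 x t; rewrite subrr enorm0 => /(_ d10 t0 td1) a1.
have := key x t; rewrite subrr enorm0 divr_gt0// => /(_ isT t0 tr).
rewrite ler_norml => /andP[a2 _].
rewrite -(ler_pM2r t0) mulNr; lra.
Qed.

(** For a locally Lipschitz [g] the directional derivative is finite and sublinear, and a
    Hahn-Banach support at [d] attains it. In particular the subdifferential is nonempty. *)
Lemma clarke_support g x d : lipschitz_near g x ->
  exists2 v, clarke g x v & clarke_le g x d (dot v d).
Proof.
move=> [M [dl dl0 hM]]; have hc := lipschitz_clarke_le dl0 hM.
pose F d := [set c : R | clarke_le g x d c].
have sF : sublinear (fun d => inf (F d)).
  apply: (inf_sublinear (lo := fun d => - (M * enorm d))).
  - by move=> u; exists (M * enorm u); exact: (hc u).1.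
  - by move=> u r /(hc u).2.
  - by move=> u v r s; exact: clarke_leD.
  - by move=> c u r c0; exact: clarke_leZ.
have [v vF vd] := sublinear_support d sF.
have Fle u c : clarke_le g x u c -> inf (F u) <= c.
  by move=> uc; apply: ge_inf => //; exists (- (M * enorm u)) => r /(hc u).2.
exists v; first by apply/clarkeP => u c uc; exact: le_trans (vF u) (Fle u c uc).
move=> c' dc'; have : inf (F d) < c' by exact: le_lt_trans vd dc'.
move=> /inf_lt[|c /= Fc cc']; last exact: Fc.
by exists (M * enorm d); exact: (hc d).1.
Qed.

(* An unbounded directional derivative would put a whole ray, given by the
   separation of its domain, into the subdifferential. *)
Lemma clarke_bounded_finite g x v0 (B : R) : clarke g x v0 ->
  (forall v, clarke g x v -> enorm v <= B) ->
  forall d, exists c, clarke_le g x d c.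
Proof.
move=> gv0 gB d; apply: contrapT => nd.
pose C d := exists c, clarke_le g x d c.
have [||||w w0 wC] := @cone_separation _ _ C d.
- by exists 0; exact: clarke_le0.
- by move=> a b [r ra] [s sb]; exists (r + s); exact: clarke_leD.
- by move=> c a c0 [r ra]; exists (c * r); exact: clarke_leZ.
- exact: nd.
have w1 : 0 < enorm w.
  by rewrite lt_def enorm_ge0 andbT; apply: contra_neq w0; exact: enorm_eq0.
(* Makes |s w| = B + 1 + |v0|, so that v0 + s w has norm at least B + 1 and violates the bound. *)
pose s := (B + 1 + enorm v0) / enorm w.
have B0 : 0 <= B by apply: le_trans (gB _ gv0); exact: enorm_ge0.
have s0 : 0 < s by rewrite divr_gt0//; have := enorm_ge0 v0; lra.
have gv : clarke g x (v0 + s *: w).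
  apply/clarkeP => u c uc; rewrite !dotE.
  have : dot w u <= 0 by apply: wC; exists c.
  have : dot v0 u <= c by move/clarkeP : gv0; apply.
  move=> ? ?; have : s * dot w u <= 0 by rewrite mulr_ge0_le0// ltW.
  lra.
have := gB _ gv; have := enormB (v0 + s *: w) v0.
rewrite [v0 + _]addrC addrK enormZ (gtr0_norm s0) /s divfK ?gt_eqF//; lra.
Qed.

(** Upper bounds in the directions of all basis vectors and their opposites are enough: the bound
    for the opposite direction, taken at the far end of a coordinate segment, is the missing lower
    bound. Nearby points are then joined by a path parallel to the axes. *)
Lemma clarke_finite_lipschitz_near g x :
  (forall d, exists c, clarke_le g x d c) -> lipschitz_near g x.
Proof.
move=> fin.
have step (d : 'rV[R]_k) : exists M, exists2 dl : R, 0 < dl &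
    forall y (t : R), enorm (y - x) < dl -> 0 < t -> t < dl ->
      g (y + t *: d) - g y <= M * t.
  have [c hc] := fin d; have [|dl dl0 h] := hc (c + 1); first by rewrite ltrDl.
  by exists (c + 1), dl.
have [M0 [d0 [d00 M00 h0]]] : exists M (d0 : R),
    [/\ 0 < d0, 0 <= M & forall j (b : bool) y (t : R),
    enorm (y - x) < d0 -> 0 < t -> t < d0 ->
      g (y + t *: ((-1) ^+ b *: delta_mx 0 j)) - g y <= M * t].
  have /choice[f hdl] (p : 'I_k * bool) : exists f : R * R, 0 < f.2 /\
      forall y (t : R), enorm (y - x) < f.2 -> 0 < t -> t < f.2 ->
      g (y + t *: ((-1) ^+ p.2 *: delta_mx 0 p.1)) - g y <= f.1 * t.
    by have [M [dl dl0 h]] := step ((-1) ^+ p.2 *: delta_mx 0 p.1); exists (M, dl).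
  pose M p := (f p).1; pose dl p := (f p).2.
  have dl0 p : 0 < dl p by have [] := hdl p.
  have D0 : 0 < 1 + \sum_p (dl p)^-1.
    by rewrite ltr_wpDr// sumr_ge0// => p _; rewrite invr_ge0 ltW.
  (* Sums replace a maximum and a minimum over the directions: the first dominates every [M p], the
     second is below every [dl p]. The added 1 covers dimension 0, where the family is empty. *)
  exists (\sum_p `|M p|), (1 + \sum_p (dl p)^-1)^-1; split.
  - by rewrite invr_gt0.
  - exact: sumr_ge0.
  move=> j b y t yx t0 td; have [_ h] := hdl (j, b).
  have dle : (1 + \sum_p (dl p)^-1)^-1 <= dl (j, b).
    rewrite -[leRHS]invrK lef_pV2 ?posrE ?invr_gt0// (bigD1 (j, b))//=.
    rewrite addrCA lerDl addr_ge0// sumr_ge0// => p _.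
    by rewrite invr_ge0 ltW.
  apply: le_trans (h y t (lt_le_trans yx dle) t0 (lt_le_trans td dle)) _.
  rewrite ler_pM2r//; apply: le_trans (ler_norm _) _.
  by rewrite (bigD1 (j, b))//= lerDl sumr_ge0.
have step1 y j (t : R) : enorm (y - x) + `|t| < d0 ->
    `|g (y + t *: delta_mx 0 j) - g y| <= M0 * `|t|.
  move=> yt; have y0 := enorm_ge0 (y - x); have t0 := normr_ge0 t.
  have de : enorm (t *: delta_mx 0 j : 'rV[R]_k) <= `|t|.
    rewrite enormZ -[leRHS]mulr1; apply: ler_wpM2l => //.
    by rewrite enorm_sqr_le// expr1n dot_delta mxE !eqxx.
  have yt' : enorm (y + t *: delta_mx 0 j - x) < d0.
    by rewrite addrAC; apply: le_lt_trans (enormD _ _) _; lra.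
  have [tn|tp|t00] := ltgtP t 0; last first.
  - by rewrite t00 scale0r addr0 subrr normr0 mulr0.
  - rewrite (gtr0_norm tp) in yt *; rewrite ler_norml.
    have := h0 j false y t; rewrite expr0 scale1r => /(_ _ tp _) a1.
    have := h0 j true (y + t *: delta_mx 0 j) t yt' tp.
    rewrite expr1 scaleN1r scalerN addrK => a2.
    have {}a1 := a1 ltac:(lra) ltac:(lra); have {}a2 := a2 ltac:(lra).
    by apply/andP; split; lra.
  - rewrite (ltr0_norm tn) in yt *; rewrite ler_norml.
    have tn' : 0 < - t by lra.
    have := h0 j true y (- t).
    rewrite expr1 scaleN1r scaleNr scalerN opprK => /(_ _ tn' _) a1.
    have := h0 j false (y + t *: delta_mx 0 j) (- t) yt' tn'.
    rewrite expr0 scale1r scaleNr addrK => a2.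
    have {}a1 := a1 ltac:(lra) ltac:(lra); have {}a2 := a2 ltac:(lra).
    by apply/andP; split; lra.
have path (s : seq 'I_k) (w : 'rV[R]_k) y :
    enorm (y - x) + \sum_(j <- s) `|w 0 j| < d0 ->
    `|g (y + \sum_(j <- s) w 0 j *: delta_mx 0 j) - g y| <=
      M0 * \sum_(j <- s) `|w 0 j|.
  elim: s y => [|j s IH] y; first by move=> _; rewrite !big_nil addr0 subrr normr0 mulr0.
  rewrite !big_cons => ys.
  have s0 : 0 <= \sum_(i <- s) `|w 0 i| by apply: sumr_ge0.
  have := IH (y + w 0 j *: delta_mx 0 j).
  rewrite addrA => /(_ _) h1.
  have de : enorm (w 0 j *: delta_mx 0 j : 'rV[R]_k) <= `|w 0 j|.
    rewrite enormZ -[leRHS]mulr1; apply: ler_wpM2l => //.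
    by rewrite enorm_sqr_le// expr1n dot_delta mxE !eqxx.
  have {}h1 := h1 ltac:(rewrite addrAC;
    have := enormD (y - x) (w 0 j *: delta_mx 0 j); lra).
  have h2 := @step1 y j (w 0 j) ltac:(lra).
  rewrite mulrDr [leRHS]addrC; apply: le_trans (lerD h1 h2).
  exact: ler_distD.
have K0 : 0 < 2 * k%:R + 1 :> R by rewrite ltr_wpDl// mulr_ge0.
(* For y and z within r of [x], the path from z to y has length at most k |y - z| <= 2 k r, so it
   stays within (2 k + 1) r of [x]. *)
exists (M0 * k%:R), (d0 / (2 * k%:R + 1)); first by rewrite divr_gt0.
move=> y z; rewrite !ltr_pdivlMr// => yx zx.
have sum_le : \sum_(j <- index_enum 'I_k) `|(y - z) 0 j| <= k%:R * enorm (y - z).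
  apply: le_trans (ler_sum _ (fun j _ => coord_le_enorm (y - z) j)) _.
  by rewrite sumr_const card_ord mulr_natl.
have := @path (index_enum 'I_k) (y - z) z.
rewrite -(row_sum_delta (y - z)) subrKC => h.
apply: le_trans (h _) _; last by rewrite -mulrA; apply: ler_wpM2l.
apply: le_lt_trans (lerD (lexx _) sum_le) _.
have := enorm_distD x y z; rewrite (enorm_distC x z) => yz.
have : k%:R * enorm (y - z) <= k%:R * (enorm (y - x) + enorm (z - x)) by apply: ler_wpM2l.
have k0 : 0 <= k%:R :> R by [].
have K1 : 0 < k%:R + 1 :> R by rewrite ltr_wpDl.
move=> kc; rewrite -(ltr_pM2r K0).
have := ler_wpM2l k0 (ltW yx); rewrite -(ltr_pM2l K1) in zx.
have := ler_wpM2r (ltW K0) kc; lra.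
Qed.

Lemma clarke_closed g x : closed (clarke g x).
Proof.
rewrite (_ : clarke g x = \bigcap_(p in [set p : 'rV[R]_k * R | clarke_le g x p.1 p.2])
    [set v | dot v p.1 <= p.2]).
  apply: closed_bigI => -[d c] _ /=.
  have cd : continuous (fun v : 'rV[R]_k => dot v d); last first.
    apply: (@preimage_closed _ _ (fun v => dot v d) [set r | r <= c]).
      by move=> v _; exact: cd.
    exact: closed_le.
  apply: (@lipschitz_continuous _ _ _ (enorm d)) => u v.
  rewrite -dotNl -dotDl mulrC ler_norml dot_le andbT.
  by rewrite -[dot _ _]opprK lerN2 -dotNl -[X in _ <= X * _]enormN dot_le.
apply/seteqP; split=> v /=.
  by move=> /clarkeP h [d c] /= /h.
by move=> h; apply/clarkeP => d c dc; exact: (h (d, c)).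
Qed.

Lemma clarke_convex g x v w (t : R) : clarke g x v -> clarke g x w ->
  0 <= t <= 1 -> clarke g x (v + t *: (w - v)).
Proof.
move=> /clarkeP gv /clarkeP gw /andP[t0 t1]; apply/clarkeP => d c dc.
have := ler_wpM2l t0 (gw d c dc).
have := ler_wpM2l (_ : 0 <= 1 - t) (gv d c dc); rewrite subr_ge0 => /(_ t1).
rewrite !dotE; lra.
Qed.

End clarke.

(** * Lebesgue measure on row vectors *)

Section measurable_rV.
Context (R : realType).

Lemma measurable_coord k (j : 'I_k) :
  measurable_fun setT (fun v : 'rV[R]_k => v 0 j).
Proof.
move=> _ Y mY; rewrite setTI; apply: sub_sigma_algebra => /=.
rewrite -bigcup_seq/=; exists j => /=; first by rewrite mem_index_enum.
by exists Y => //; rewrite setTI.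
Qed.

Lemma measurable_fun_rV d (T : measurableType d) k (f : T -> 'rV[R]_k) :
  (forall j, measurable_fun setT (fun x => f x 0 j)) -> measurable_fun setT f.
Proof.
move=> mf _ A mA; rewrite setTI.
suff sub : measurable `<=` [set B | measurable (f @^-1` B)] by exact: sub.
apply: smallest_sub.
  split => [|B mB|F mF] /=.
  - by rewrite preimage_set0.
  - by rewrite setTD -preimage_setC; exact: measurableC.
  - by rewrite preimage_bigcup; apply: bigcupT_measurable.
move=> B; rewrite -bigcup_seq/= => -[j _ [C mC <-]] /=.
by rewrite setTI; have := mf j measurableT C mC; rewrite setTI.
Qed.

Definition cons_rV k (p : measurableTypeR R * 'rV[R]_k) : 'rV[R]_k.+1 :=
  row_mx (p.1 : R)%:M p.2.

Lemma cons_rV0 k p : @cons_rV k p 0 0 = p.1.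
Proof.
transitivity (((p.1 : R)%:M : 'M[R]_1) 0 0); last by rewrite mxE eqxx mulr1n.
rewrite -(row_mxEl ((p.1 : R)%:M : 'M[R]_1) p.2 0 0).
by congr (row_mx _ _ _ _); exact/val_inj.
Qed.

Lemma cons_rVS k p j : @cons_rV k p 0 (lift ord0 j) = p.2 0 j.
Proof.
rewrite -(row_mxEr (p.1%:M : 'M[R]_1) p.2 0 j).
by congr (row_mx _ _ _ _); exact/val_inj.
Qed.

Lemma measurable_cons_rV k : measurable_fun setT (@cons_rV k).
Proof.
apply: measurable_fun_rV => j.
have [j' ->|->] := unliftP ord0 j.
  under eq_fun do rewrite cons_rVS.
  exact: (measurableT_comp (measurable_coord j')).
under eq_fun do rewrite cons_rV0.
exact: measurable_fst.
Qed.

Lemma lebesgue_rVS k (A : set 'rV[R]_k.+1) :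
  lebesgue_rV A = (\int[@lebesgue_measure R]_x
    @lebesgue_rV R k [set y | A (cons_rV (x, y))])%E.
Proof.
rewrite /=; apply: eq_integral => x _ /=; congr lebesgue_rV.
by apply/seteqP; split=> y; rewrite /xsection/= inE.
Qed.

(** [lebesgue_rV] is a bare set function. It is recognised as the pushforward of a product measure
    under [cons_rV], so that integration theory applies; sigma-finiteness goes through the induction
    because forming the next product requires it. *)
Lemma lebesgue_rV_exists k :
  exists mu : {sigma_finite_measure set 'rV[R]_k -> \bar R},
    (mu : set _ -> _) = @lebesgue_rV R k.
Proof.
elim: k => [|k [mu muE]]; first by exists (dirac (0 : 'rV[R]_0)).
have mC := @measurable_cons_rV k.
pose push : {measure set 'rV[R]_k.+1 -> \bar R} :=
  pushforward (@lebesgue_measure R \x mu)%E (@cons_rV k).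
pose nu := push mC.
have nuS : sigma_finite setT nu.
  have /sigma_finiteP[F [FT ndF Foo]] := sigma_finiteT (@lebesgue_measure R).
  have /sigma_finiteP[G [GT ndG Goo]] := sigma_finiteT mu.
  (* Left inverse of [cons_rV]: exhausting rectangles of the product are carried to row vectors as
     preimages under it. *)
  pose tl (v : 'rV[R]_k.+1) : measurableTypeR R * 'rV[R]_k :=
    (v 0 0, \row_j v 0 (lift ord0 j)).
  have tlK p : tl (cons_rV p) = p.
    case: p => a b; rewrite /tl cons_rV0; congr pair.
    by apply/rowP => j; rewrite mxE cons_rVS.
  have mtl : measurable_fun setT tl.
    apply/measurable_fun_pairP; split; first exact: measurable_coord.
    apply: measurable_fun_rV => j /=.
    under eq_fun do rewrite mxE.
    exact: measurable_coord.
  exists (fun i => tl @^-1` (F i `*` G i)).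
    rewrite -preimage_bigcup; apply/esym; rewrite -subTset => v _ /=.
    have : setT (tl v).1 by []. have : setT (tl v).2 by [].
    rewrite FT GT => -[i _ Gi] [j _ Fj]; exists (maxn i j) => //; split.
      by move: Fj; apply/subsetPset/ndF/leq_maxr.
    by move: Gi; apply/subsetPset/ndG/leq_maxl.
  move=> i; have [mFi Fioo] := Foo i; have [mGi Gioo] := Goo i; split.
    rewrite -[X in measurable X]setTI.
    by apply: mtl => //; exact: measurableX.
  rewrite /nu/= /pushforward (_ : _ @^-1` _ = F i `*` G i).
    by rewrite product_measure1E// lte_mul_pinfty// ge0_fin_numE.
  by apply/seteqP; split=> p; rewrite /preimage/mkset tlK.
pose nuM := Measure_isSigmaFinite.Build _ _ _ nu nuS.
pose nu' : {sigma_finite_measure set 'rV[R]_k.+1 -> \bar R} :=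
  HB.pack_for (SigmaFiniteMeasure.type 'rV[R]_k.+1 R) (Measure.sort nu) nuM.
exists nu'; rewrite /nu'/= /pushforward /= muE; apply/funext => A.
by rewrite /=.
Qed.

Definition rV_lebesgue k := projT1 (cid (lebesgue_rV_exists k)).

Lemma rV_lebesgueE k : (rV_lebesgue k : set _ -> _) = @lebesgue_rV R k.
Proof. exact: projT2 (cid (lebesgue_rV_exists k)). Qed.

End measurable_rV.

Section lebesgue_shift.
Context (R : realType).
Notation leb := (@lebesgue_measure R).
Local Open Scope ereal_scope.

Lemma lebesgue_measure_shift (a : R) (A : set R) : measurable A ->
  pushforward leb (fun x : measurableTypeR R => (x + a)%R : measurableTypeR R) A
  = leb A.
Proof.
move=> mA.
have ms : measurable_fun setT
    (fun x : measurableTypeR R => (x + a)%R : measurableTypeR R).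
  exact: measurable_funD.
pose push : {measure set (measurableTypeR R) -> \bar R} :=
  pushforward leb (fun x : measurableTypeR R => (x + a)%R : measurableTypeR R).
pose nu := push ms.
apply/esym/(@lebesgue_measure_unique R nu) => //= _ [[u v]] _ <-.
rewrite /pushforward/= (_ : _ @^-1` _ = `](u - a)%R, (v - a)%R]%classic); last first.
  by apply/seteqP; split=> x /=; rewrite !in_itv/= ltrBlDr lerBrDr.
rewrite !lebesgue_measure_itv/= !lte_fin ltrD2r; case: ifPn => // _.
by rewrite -!EFinD opprB addrA subrK.
Qed.

Lemma ge0_integral_shift (a : R) (f : R -> \bar R) :
  measurable_fun setT f -> (forall x, 0 <= f x) ->
  \int[leb]_x f (x + a)%R = \int[leb]_x f x.
Proof.
move=> mf f0.
pose s := fun x : measurableTypeR R => (x + a)%R : measurableTypeR R.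
have ms : measurable_fun setT s by exact: measurable_funD.
have := @ge0_integral_pushforward _ _ _ _ R s ms leb setT f measurableT mf
  (fun y _ => f0 y).
rewrite preimage_setT => <-.
by apply: eq_measure_integral => A mA _; exact: lebesgue_measure_shift.
Qed.

End lebesgue_shift.

Section rV_lebesgue.
Context (R : realType).
Notation lam k := (@rV_lebesgue R k).
Notation leb := (@lebesgue_measure R).
Local Open Scope ereal_scope.

Lemma rV_lebesgueS k (A : set 'rV[R]_k.+1) :
  lam k.+1 A = (leb \x lam k) (@cons_rV R k @^-1` A).
Proof. by rewrite !rV_lebesgueE. Qed.

Lemma rV_lebesgueSE k (A : set 'rV[R]_k.+1) :
  lam k.+1 A = \int[leb]_x lam k [set y | A (cons_rV (x, y))].
Proof. by rewrite !rV_lebesgueE lebesgue_rVS. Qed.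

Lemma measurable_section_rV k (A : set 'rV[R]_k.+1) : measurable A ->
  measurable_fun setT (fun x : measurableTypeR R => lam k [set y | A (cons_rV (x, y))]).
Proof.
move=> mA.
have mC : measurable (@cons_rV R k @^-1` A).
  by rewrite -[X in measurable X]setTI; exact: measurable_cons_rV.
have := measurable_fun_xsection (lam k) mC.
congr measurable_fun; apply/funext => x /=; congr (lam k _).
by apply/seteqP; split=> y; rewrite /xsection/= inE.
Qed.

(** Slicing along the first coordinate: the tail of [v] shifts each slice, handled by induction, and
    its head shifts the outer variable. *)
Lemma rV_lebesgue_shift k (v : 'rV[R]_k) (A : set 'rV[R]_k) : measurable A ->
  lam k [set u | A (u + v)%R] = lam k A.
Proof.
elim: k v A => [|k IH] v A mA.
  congr (lam 0 _); apply/seteqP.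
  by split=> u /=; rewrite (_ : (u + v = u)%R)//; apply/rowP; case.
pose w : 'rV[R]_k := (\row_j v 0 (lift ord0 j))%R.
have cD x y : (cons_rV (x, y) + v = cons_rV ((x + v 0 0)%R, y + w))%R.
  apply/rowP => j; rewrite mxE; have [i ->|->] := unliftP ord0 j.
    by rewrite !cons_rVS /= !mxE.
  by rewrite !cons_rV0.
rewrite !rV_lebesgueSE.
pose g x := lam k [set y | A (cons_rV (x, y))].
rewrite -[RHS](ge0_integral_shift (v 0%R 0%R) (f := g)).
- apply: eq_integral => x _ /=; rewrite -[RHS](IH w).
    by congr (lam k _); apply/seteqP; split=> y /=; rewrite cD.
  have mc : measurable_fun setT (fun y => @cons_rV R k ((x + v 0 0)%R, y)).
    by apply: (measurableT_comp (@measurable_cons_rV R k)); exact: pair1_measurable.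
  by rewrite -[X in measurable X]setTI; exact: mc.
- exact: measurable_section_rV.
- by move=> x; exact: measure_ge0.
Qed.

Lemma measurable_enorm k : measurable_fun setT (@enorm R k).
Proof.
have -> : @enorm R k = Num.sqrt \o (fun v => \sum_(j < k) v 0 j ^+ 2)%R by [].
apply: measurableT_comp.
  by apply: continuous_measurable_fun => x; exact: sqrt_continuous.
apply: measurable_sum => j; apply: measurable_funX; exact: measurable_coord.
Qed.

Lemma measurable_eball k : measurable (@eball R k).
Proof.
rewrite (_ : @eball R k = setT `&` @enorm R k @^-1` [set x | x <= 1]%R).
  by apply: measurable_enorm => //; rewrite -set_itvE; exact: measurable_itv.
by rewrite setTI.
Qed.

(** The volume of a cube follows at once from the product structure; cubes around and inside the
    ball show that its volume is finite and positive. *)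
Definition cube k (r : R) : set 'rV[R]_k := [set v | forall j, (`|v 0 j| <= r)%R].
Arguments cube : clear implicits.

Lemma measurable_cube k r : measurable (cube k r).
Proof.
have mn (j : 'I_k) : measurable [set v : 'rV[R]_k | (`|v 0 j| <= r)%R].
  have : measurable_fun setT (fun v : 'rV[R]_k => `|v 0 j|)%R.
    by apply: measurableT_comp => //; exact: measurable_coord.
  move=> /(_ measurableT `]-oo, r]%classic (measurable_itv _)); rewrite setTI.
  by congr measurable; apply/seteqP; split=> v /=; rewrite in_itv.
have -> : cube k r = \bigcap_(j in [set: 'I_k]) [set v | (`|v 0 j| <= r)%R].
  by apply/seteqP; split=> v /= vr j => [_|]; [exact: vr|exact: (vr j I)].
by apply: fin_bigcap_measurable => [|j _]; [exact: finite_finset|exact: mn].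
Qed.

Lemma rV_lebesgue_cube k (r : R) : (0 <= r)%R ->
  lam k (cube k r) = ((r *+ 2) ^+ k)%:E.
Proof.
move=> r0; elim: k => [|k IH].
  rewrite rV_lebesgueE/= diracE mem_set//.
  by case.
rewrite rV_lebesgueS (_ : _ @^-1` _ = `[(- r)%R, r]%classic `*` cube k r).
  transitivity (leb `[(- r)%R, r]%classic * lam k (cube k r)).
    by apply: product_measure1E => //; exact: measurable_cube.
  rewrite IH lebesgue_measure_itv/= lte_fin exprS.
  case: ltP => rr; first by rewrite -EFinD opprK -EFinM mulr2n.
  have -> : r = 0%R by lra.
  by rewrite mul0rn mul0r mul0e.
apply/seteqP; split=> [[x y]|[x y]] /=.
  move=> h; split=> [|j].
    by have := h ord0; rewrite cons_rV0 in_itv/= ler_norml.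
  by have := h (lift ord0 j); rewrite cons_rVS.
rewrite in_itv/= -ler_norml => -[xr yr] j.
have [i ->|->] := unliftP ord0 j; last by rewrite cons_rV0.
by rewrite cons_rVS.
Qed.

Lemma rV_lebesgue_bounded k (A : set 'rV[R]_k) (r : R) : measurable A ->
  (forall v, A v -> enorm v <= r)%R -> lam k A < +oo.
Proof.
move=> mA Ar; apply: (@le_lt_trans _ _ (lam k (cube k `|r|%R))).
  apply: le_measure; rewrite ?inE//; first exact: measurable_cube.
  move=> v /Ar vr j; apply: le_trans (coord_le_enorm v j) _.
  exact: le_trans vr (ler_norm _).
by rewrite rV_lebesgue_cube// ltry.
Qed.

Lemma rV_lebesgue_eball_lty k : lam k (@eball R k) < +oo.
Proof. by apply: (@rV_lebesgue_bounded _ _ 1%R); first exact: measurable_eball. Qed.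

Lemma rV_lebesgue_eball_gt0 k : 0 < lam k (@eball R k).
Proof.
(* The coordinates of a point of this cube have absolute sum at most k / (k + 1) <= 1; k + 1 rather
   than k admits dimension 0. *)
pose r : R := (k.+1%:R)^-1%R.
have r0 : (0 < r)%R by rewrite invr_gt0 ltr0n.
apply: (@lt_le_trans _ _ (lam k (cube k r))).
  by rewrite rV_lebesgue_cube ?ltW// lte_fin exprn_gt0// pmulrn_lgt0.
apply: le_measure; rewrite ?inE; [exact: measurable_cube|exact: measurable_eball|].
move=> v vr; apply: le_trans (enorm_le_sum v) _.
apply: le_trans (ler_sum _ (fun j _ => vr j)) _.
rewrite sumr_const card_ord -mulr_natl ler_pdivrMr ?ltr0n// mul1r ler_nat.
exact: leqnSn.
Qed.

(** The slice at first coordinate x is a sphere of squared radius s - x^2: null by induction if this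
    is positive, empty if negative, and the two remaining values of x are negligible. Positivity of
    [s] matters in dimension 0, where the sphere of radius 0 is the whole space. *)
Lemma rV_lebesgue_sphere k (s : R) : (0 < s)%R ->
  lam k [set v | dot v v = s] = 0.
Proof.
elim: k s => [|k IH] s s0.
  rewrite (_ : [set _ | _] = set0) ?measure0// -subset0 => v /=.
  by rewrite /dot big_ord0 => s0'; move: s0; rewrite -s0' ltxx.
have dotS x y : dot (cons_rV (x, y)) (@cons_rV R k (x, y)) = (x ^+ 2 + dot y y)%R.
  rewrite /dot big_ord_recl cons_rV0 -expr2; congr (_ + _)%R.
  by apply: eq_bigr => j _; rewrite cons_rVS.
have mS : measurable [set v : 'rV[R]_k.+1 | dot v v = s].
  rewrite (_ : [set _ | _] =
      setT `&` (fun v : 'rV[R]_k.+1 => dot v v) @^-1` [set s]) ?setTI//.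
  rewrite -[X in measurable X]setTI.
  have : measurable_fun setT (fun v : 'rV[R]_k.+1 => dot v v).
    by apply: measurable_sum => j; apply: measurable_funM; exact: measurable_coord.
  by apply.
rewrite rV_lebesgueSE.
pose g x := lam k [set y | dot (cons_rV (x, y)) (@cons_rV R k (x, y)) = s].
have gE : ae_eq leb setT g (cst 0).
  exists ([set Num.sqrt s] `|` [set - Num.sqrt s]%R); split.
  - exact: measurableU.
  - apply: null_set_setU => //; exact: lebesgue_measure_set1.
  move=> x /= /not_implyP[_]; apply: contra_notP => /not_orP[xs xNs].
  have xs2 : (x ^+ 2 != s)%R.
    apply/eqP => x2; have : x = `|x|%R \/ x = (- `|x|)%R.
      by case: (ger0P x) => _; [left|right; rewrite opprK].
    by rewrite -sqrtr_sqr x2 => -[]; [exact: xs|exact: xNs].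
  have [xlts|slex] := ltP (x ^+ 2)%R s.
    rewrite /g -[RHS](IH (s - x ^+ 2)%R) ?subr_gt0//; congr (lam k _).
    by apply/seteqP; split=> y /=; rewrite dotS; lra.
  rewrite /g (_ : [set _ | _] = set0) ?measure0// -subset0 => y /=.
  rewrite dotS => h; move/eqP: xs2; apply.
  have := dotvv_ge0 y; lra.
transitivity (\int[leb]_x (cst 0 x)); last by rewrite integral0.
apply: ae_eq_integral => //.
exact: measurable_section_rV.
Qed.

(** Continuity from above along annuli of finite measure that shrink to the unit sphere, which is
    null. *)
Lemma rV_lebesgue_annulus k (e : R) : (0 < e)%R ->
  exists2 dl, (0 < dl)%R & forall A : set 'rV[R]_k, measurable A ->
    (forall v, A v -> `|enorm v - 1| <= dl)%R -> lam k A <= e%:E.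
Proof.
move=> e0.
pose F (i : nat) := [set v : 'rV[R]_k | (`|enorm v - 1| <= i.+1%:R^-1)%R].
have mF i : measurable (F i).
  have mf : measurable_fun setT (fun v : 'rV[R]_k => `|enorm v - 1|%R).
    apply: measurableT_comp => //; apply: measurable_funB => //.
    exact: measurable_enorm.
  rewrite (_ : F i = setT `&` (fun v : 'rV[R]_k => `|enorm v - 1|)%R @^-1`
    [set x | x <= i.+1%:R^-1]%R) ?setTI//.
  rewrite -[X in measurable X]setTI; apply: mf => //; rewrite -set_itvE.
  exact: measurable_itv.
have F0 : lam k (\bigcap_i F i) = 0.
  rewrite -(rV_lebesgue_sphere k (@ltr01 R)); congr (lam k _).
  apply/seteqP; split=> v /=.
    move=> Fv; rewrite -enormE; suff -> : enorm v = 1%R by rewrite expr1n.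
    apply/eqP; rewrite -subr_eq0 -normr_eq0 eq_le normr_ge0 andbT.
    apply/ler_addgt0Pl => x x0; rewrite addr0.
    have [i ix] := ltr_add_invr (y := 0%R) (x := x) x0.
    apply: le_trans (Fv i I) _; rewrite add0r in ix; exact: ltW.
  move=> vv1 i _; rewrite /F/=; suff -> : enorm v = 1%R by rewrite subrr normr0 invr_ge0.
  by apply/eqP; rewrite -(eqrXn2 (n := 2)) ?enorm_ge0// enormE vv1 expr1n.
have : lam k \o F @ \oo --> 0.
  rewrite -F0; apply: nonincreasing_cvg_mu => //.
  - apply: (@rV_lebesgue_bounded _ _ 2%R) => // v; rewrite /F/= invr1.
    by rewrite ler_norml; lra.
  - exact: bigcapT_measurable.
  - move=> i j ij; apply/subsetPset => v; rewrite /F/= => /le_trans; apply.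
    by rewrite lef_pV2 ?posrE ?ltr0n// ler_nat.
move/fine_cvgP => -[Ffin /cvgrPdist_le/(_ _ e0)].
move=> /(filterI Ffin)[i _ /(_ i (leqnn i))] /= [fi].
rewrite sub0r normrN => le_e.
exists i.+1%:R^-1%R => // A mA AF.
apply: le_trans (_ : lam k (F i) <= _).
  by apply: le_measure; rewrite ?inE.
rewrite -(fineK fi) lee_fin; exact: le_trans (ler_norm _) le_e.
Qed.

(** The sigma-algebra is generated by coordinates, not by open sets. The set where f > a is written
    as a countable union, over rational points p, of the measurable sets where f(p) - M |y - p| >
    a. *)
Lemma lipschitz_measurable k (f : 'rV[R]_k -> R) M :
  (forall x y, `|f x - f y| <= M * enorm (x - y))%R -> measurable_fun setT f.
Proof.
move=> fM; apply: (measurability _ (RGenOInfty.measurableE R)).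
move=> _ [_ [a ->] <-]; rewrite setTI.
pose B (q : 'rV[rat]_k) : set 'rV[R]_k :=
  [set y | a < f (map_mx ratr q) - M * enorm (y - map_mx ratr q)]%R.
have mB q : measurable (B q).
  have : measurable_fun setT (fun y : 'rV[R]_k =>
      f (map_mx ratr q) - M * enorm (y - map_mx ratr q))%R.
    apply: measurable_funB => //; apply: measurable_funM => //.
    apply: (measurableT_comp (@measurable_enorm k)).
    apply: measurable_fun_rV => j.
    under eq_fun do rewrite 2!mxE.
    by apply: measurable_funD => //; exact: measurable_coord.
  move=> /(_ measurableT `]a, +oo[%classic (measurable_itv _)); rewrite setTI.
  by congr measurable; apply/seteqP; split=> y /=; rewrite in_itv/= andbT.
rewrite (_ : f @^-1` _ = \bigcup_(q in [set: 'rV[rat]_k]) B q).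
  exact: countable_bigcupT_measurable.
apply/seteqP; split=> y /=; rewrite in_itv/= andbT.
  move=> afy.
  (* Replacing y by a point p with coordinates within e loses at most 2 |M| k e: once in f(p), once
     in M |y - p|. The added 1 makes the loss smaller than f(y) - a. *)
  pose M' := (2 * `|M| * k%:R + 1)%R.
  have M'0 : (0 < M')%R by rewrite ltr_wpDl// !mulr_ge0.
  pose e := ((f y - a) / M')%R.
  have e0 : (0 < e)%R by rewrite divr_gt0// subr_gt0.
  have /choice[q qy] : forall j : 'I_k, exists q : rat, (`|y 0 j - ratr q| < e)%R.
    move=> j; have /rat_in_itvoo[q] : (y 0 j - e < y 0 j + e)%R by lra.
    by rewrite in_itv/= => ?; exists q; rewrite ltr_norml; lra.
  exists (\row_j q j)%R => //; rewrite /B/=.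
  set p := map_mx _ _.
  have yp : (enorm (y - p) <= k%:R * e)%R.
    apply: le_trans (enorm_le_sum _) _.
    have h j : (`|(y - p) 0 j| <= e)%R by rewrite !mxE ltW.
    apply: le_trans (ler_sum _ (fun j _ => h j)) _.
    by rewrite sumr_const card_ord mulr_natl.
  have fyp := fM y p.
  have Mp : (M * enorm (y - p) <= `|M| * (k%:R * e))%R.
    exact: le_trans (ler_wpM2r (enorm_ge0 _) (ler_norm M)) (ler_wpM2l (normr_ge0 _) yp).
  have ee : (M' * e = f y - a)%R by rewrite /e mulrC divfK// gt_eqF.
  have : (2 * (`|M| * (k%:R * e)) < f y - a)%R.
    have : (M' * e = 2 * (`|M| * (k%:R * e)) + e)%R by rewrite /M'; ring.
    by rewrite ee => ->; rewrite ltrDl.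
  move: fyp; rewrite ler_norml => /andP[_]; lra.
move=> [q _]; rewrite /B/= => /lt_le_trans; apply.
have := fM (map_mx ratr q) y; rewrite ler_norml (enorm_distC _ y).
by move=> /andP[]; lra.
Qed.

End rV_lebesgue.

(** * Differentiability of the ball average *)

Section almost_additive.
Context (R : realType).

(** Taking t = 0 forces phi 0 = 0: this is differentiability at 0 of a function vanishing there,
    stated without quotients. *)
Definition has_slope (phi : R -> R) (l : R) := forall e : R, 0 < e ->
  exists2 dl : R, 0 < dl & forall t, `|t| <= dl -> `|phi t - t * l| <= e * `|t|.

Lemma has_slope_uniq phi l l' : has_slope phi l -> has_slope phi l' -> l = l'.
Proof.
move=> hl hl'; apply/eqP; rewrite -subr_eq0 -normr_le0.
apply/ler_addgt0Pl => e e0; rewrite addr0.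
have e20 : 0 < e / 2 by rewrite divr_gt0.
have [d1 d10 h1] := hl _ e20; have [d2 d20 h2] := hl' _ e20.
pose t := Num.min d1 d2.
have t0 : 0 < t by rewrite lt_min d10.
have tE : `|t| = t by rewrite gtr0_norm.
have := h1 t; have := h2 t; rewrite tE /t !ge_min !lexx orbT => /(_ isT) a2 /(_ isT) a1.
have : `|t * (l - l')| <= e * t.
  have -> : t * (l - l') = (phi t - t * l') - (phi t - t * l) by ring.
  apply: le_trans (ler_normB _ _) _.
  have -> : e * t = e / 2 * t + e / 2 * t by field.
  exact: lerD.
by rewrite normrM tE mulrC ler_pM2r.
Qed.

Lemma has_slopeD phi psi l l' : has_slope phi l -> has_slope psi l' ->
  has_slope (phi \+ psi) (l + l').
Proof.
move=> h1 h2 e e0; have e20 : 0 < e / 2 by rewrite divr_gt0.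
have [d1 d10 {}h1] := h1 _ e20; have [d2 d20 {}h2] := h2 _ e20.
exists (Num.min d1 d2); first by rewrite lt_min d10.
move=> t; rewrite le_min => /andP[/h1 {}h1 /h2 {}h2] /=.
have -> : phi t + psi t - t * (l + l') = (phi t - t * l) + (psi t - t * l') by ring.
apply: le_trans (ler_normD _ _) _.
have -> : e * `|t| = e / 2 * `|t| + e / 2 * `|t| by field.
exact: lerD.
Qed.

Lemma has_slope_scale phi l c : has_slope phi l ->
  has_slope (fun t => phi (t * c)) (c * l).
Proof.
move=> h e e0; have c0 : 0 < `|c| + 1 by rewrite ltr_wpDl.
have [|d d0 {}h] := h (e / (`|c| + 1)); first by rewrite divr_gt0.
exists (d / (`|c| + 1)); first by rewrite divr_gt0.
move=> t; rewrite ler_pdivlMr// => td.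
have tc : `|t * c| <= `|t| * (`|c| + 1).
  by rewrite normrM ler_wpM2l// lerDl.
have := h _ (le_trans tc td); rewrite mulrA => /le_trans; apply.
apply: le_trans (ler_wpM2l _ tc) _; first by rewrite divr_ge0 ?ltW.
by rewrite mulrCA [_ * (`|c| + 1)]divfK ?gt_eqF// mulrC.
Qed.

Lemma has_slope_derive (V : normedModType R) (f : V -> R) (x v : V) l :
  has_slope (fun t => f (x + t *: v) - f x) l -> is_derive x v f l.
Proof.
move=> h.
suff fl : (fun t => t^-1 *: ((f \o shift x) (t *: v) - f x)) @ 0^' --> (l : R^o).
  by apply: DeriveDef; [apply/cvg_ex; exists l|exact/cvg_lim].
apply/cvgrPdist_le => e e0; have [d d0 {}h] := h _ e0.
near=> t.
have t0 : t != 0 by near: t; exact: nbhs_dnbhs_neq.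
have td : `|t| <= d by near: t; exact: dnbhs0_le.
rewrite /= (addrC _ x) distrC.
have -> : t^-1 *: (f (x + t *: v) - f x) - l = t^-1 * (f (x + t *: v) - f x - t * l).
  by rewrite mulrBr mulrA mulVf// mul1r.
by rewrite normrM normfV ler_pdivrMl ?normr_gt0// [leRHS]mulrC h.
Unshelve. all: by end_near. Qed.

Section scalar.
Variables (phi : R -> R) (C : R).
Hypothesis C0 : 0 <= C.
Hypothesis phiC : forall t, `|phi t| <= C * `|t|.
(** Asymmetric on purpose: only [s] has to be small, while the error is relative to [t]. Adding [t]
    repeatedly then costs e |t| each time, as long as the running sum stays below dl. *)
Hypothesis phiA : forall e : R, 0 < e -> exists2 dl : R, 0 < dl &
  forall s t, `|s| <= dl -> `|phi (s + t) - phi s - phi t| <= e * `|t|.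

Let phi0 : phi 0 = 0.
Proof. by apply/eqP; rewrite -normr_le0 (le_trans (phiC 0))// normr0 mulr0. Qed.

Let multiples (e dl t : R) : 0 < t ->
  (forall s t, `|s| <= dl -> `|phi (s + t) - phi s - phi t| <= e * `|t|) ->
  forall n : nat, n%:R * t <= dl ->
  `|phi (n%:R * t) - n%:R * phi t| <= n%:R * (e * t).
Proof.
move=> t0 h; elim=> [|n IH] nt; first by rewrite !mul0r phi0 subrr normr0.
have nt' : n%:R * t <= dl.
  by apply: le_trans nt; apply: ler_wpM2r; [exact: ltW|rewrite ler_nat].
rewrite -natr1 !mulrDl !mul1r.
have -> : phi (n%:R * t + t) - (n%:R * phi t + phi t) =
  (phi (n%:R * t + t) - phi (n%:R * t) - phi t) +
  (phi (n%:R * t) - n%:R * phi t) by ring.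
apply: le_trans (ler_normD _ _) _; rewrite addrC; apply: lerD; first exact: IH.
have := h (n%:R * t) t; rewrite ger0_norm; last by rewrite mulr_ge0// ltW.
by rewrite (gtr0_norm t0); apply.
Qed.

(** Fix a small s and write s = n t + r with 0 <= r < t. Additivity gives phi(s) close to n phi(t),
    so phi(t) / t is close to phi(s) / s for every t much smaller than s. *)
Let approx_pos (e : R) : 0 < e -> exists q : R, exists2 dl : R, 0 < dl &
  forall t : R, 0 < t -> t <= dl -> `|phi t - t * q| <= e * t.
Proof.
move=> e0; have e20 : 0 < e / 2 by rewrite divr_gt0.
have [s s0 h] := phiA e20.
have D0 : 0 < 2 * C + 1 by rewrite ltr_wpDl// mulr_ge0.
(* The second threshold absorbs the rounding terms caused by r, at most 2 C t^2, into the remaining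
   half of the error e s t. *)
exists (phi s / s); exists (Num.min s (e / 2 * s / (2 * C + 1))).
  by rewrite lt_min s0/= divr_gt0 ?mulr_gt0.
move=> t t0; rewrite le_min => /andP[ts].
rewrite ler_pdivlMr// => tC.
pose n := Num.truncn (s / t).
have st0 : 0 <= s / t by rewrite divr_ge0 ?ltW.
have /andP[n1 n2] := truncn_itv st0; rewrite -/n in n1 n2.
rewrite ler_pdivlMr// in n1; rewrite ltr_pdivrMr// -natr1 mulrDl mul1r in n2.
have m := multiples t0 h n1.
set r := s - n%:R * t.
have r0 : 0 <= r by rewrite subr_ge0.
have rt : r <= t by rewrite /r; lra.
have sE : n%:R * t + r = s by rewrite /r addrC subrK.
have nt0 : 0 <= n%:R * t by rewrite mulr_ge0// ltW.
have := h (n%:R * t) r; rewrite sE (ger0_norm r0) ger0_norm// => /(_ n1) h1.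
have pr := phiC r; rewrite (ger0_norm r0) in pr.
have pt := phiC t; rewrite (gtr0_norm t0) in pt.
have A1 : `|phi s - n%:R * phi t| <= e / 2 * s + C * t.
  have -> : phi s - n%:R * phi t = (phi s - phi (n%:R * t) - phi r) + phi r +
    (phi (n%:R * t) - n%:R * phi t) by ring.
  have -> : e / 2 * s + C * t =
    e / 2 * r + C * t + n%:R * (e / 2 * t) by rewrite -{1}sE; ring.
  apply: le_trans (ler_normD _ _) (lerD _ m).
  apply: le_trans (ler_normD _ _) (lerD h1 _).
  by apply: le_trans pr _; exact: ler_wpM2l.
have A2 : `|s * phi t - t * phi s| <= e / 2 * s * t + 2 * C * t * t.
  have -> : s * phi t - t * phi s = r * phi t - t * (phi s - n%:R * phi t).
    by rewrite -{1}sE; ring.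
  apply: le_trans (ler_normB _ _) _; rewrite !normrM (ger0_norm r0) (gtr0_norm t0).
  have : r * `|phi t| <= t * (C * t) by exact: ler_pM.
  have : t * `|phi s - n%:R * phi t| <= t * (e / 2 * s + C * t).
    by apply: ler_wpM2l A1; exact: ltW.
  by lra.
have -> : phi t - t * (phi s / s) = (s * phi t - t * phi s) / s.
  by field; rewrite gt_eqF.
rewrite normrM normfV (gtr0_norm s0) ler_pdivrMr//.
apply: le_trans A2 _.
have : t * (2 * C + 1) * t <= e / 2 * s * t by rewrite ler_pM2r.
have : 0 <= t * t by rewrite mulr_ge0 ?ltW.
lra.
Qed.

Let approx (e : R) : 0 < e -> exists q : R, exists2 dl : R, 0 < dl &
  forall t, `|t| <= dl -> `|phi t - t * q| <= e * `|t|.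
Proof.
move=> e0; have e20 : 0 < e / 2 by rewrite divr_gt0.
have [q [d1 d10 h1]] := approx_pos e20; have [d2 d20 h2] := phiA e20.
exists q; exists (Num.min d1 d2); first by rewrite lt_min d10.
move=> t; rewrite le_min => /andP[td1 td2].
have [t0|t0|->] := ltgtP t 0; last by rewrite phi0 mul0r subrr normr0 mulr0.
- have Nt0 : 0 < - t by rewrite oppr_gt0.
  have := h2 t (- t) td2; rewrite subrr phi0 normrN.
  rewrite (ltr0_norm t0) in td1 *; have := h1 _ Nt0 td1 => {}h1 {}h2.
  have -> : phi t - t * q = - ((0 - phi t - phi (- t)) + (phi (- t) - (- t) * q)).
    by ring.
  rewrite normrN; apply: le_trans (ler_normD _ _) _.
  have -> : e * - t = e / 2 * - t + e / 2 * - t by field.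
  exact: lerD.
- rewrite (gtr0_norm t0) in td1 *; apply: le_trans (h1 _ t0 td1) _.
  by apply: ler_wpM2r; [exact: ltW|lra].
Qed.

(** An approximate slope at every precision makes phi(t) / t Cauchy as t tends to 0; completeness
    gives the limit. *)
Lemma almost_additive_slope : exists l, has_slope phi l.
Proof.
have : cvg ((fun t => phi t / t : R^o) @ 0^').
  apply: cauchy_cvg; apply: cauchy_exP => e e0.
  have e20 : 0 < e / 2 by rewrite divr_gt0.
  have [q [d d0 h]] := approx e20; exists q.
  suff H : \forall t \near 0^', ball (q : R^o) e (phi t / t) by exact: H.
  near=> t.
  have t0 : t != 0 by near: t; exact: nbhs_dnbhs_neq.
  have td : `|t| <= d by near: t; exact: dnbhs0_le.
  rewrite -ball_normE /= distrC.
  have -> : phi t / t - q = (phi t - t * q) / t by field.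
  rewrite normrM normfV ltr_pdivrMr ?normr_gt0//.
  apply: le_lt_trans (h t td) _; rewrite ltr_pM2r ?normr_gt0//; lra.
move=> /cvg_ex[l] /cvgrPdist_le fl; exists l => e e0.
have := fl e e0 => /nbhs_ballP[d/= d0 h].
exists (d / 2); first by rewrite divr_gt0.
move=> t td; have [->|t0] := eqVneq t 0.
  by rewrite phi0 mul0r subrr normr0 mulr0.
have := h t; rewrite -ball_normE /= sub0r normrN => /(_ _ t0).
have td' : `|t| < d by lra.
move=> /(_ td'); rewrite distrC.
have -> : phi t / t - l = (phi t - t * l) / t by field.
by rewrite normrM normfV ler_pdivrMr ?normr_gt0.
Unshelve. all: by end_near. Qed.

End scalar.

(** The slope exists on every line. It is additive in [v] because a(t (v + w)) - a(t v) - a(t w) is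
    o(t), hence linear, and its values on the basis form the vector [g]. *)
Lemma almost_additive_linear k (a : 'rV[R]_k -> R) C : 0 <= C ->
  (forall v, `|a v| <= C * enorm v) ->
  (forall e : R, 0 < e -> exists2 dl : R, 0 < dl & forall v w, enorm v <= dl ->
     `|a (v + w) - a v - a w| <= e * enorm w) ->
  exists g, forall v, has_slope (fun t => a (t *: v)) (dot g v).
Proof.
move=> C0 aC aA.
have /choice[l lP] v : exists l, has_slope (fun t => a (t *: v)) l.
  apply: (@almost_additive_slope _ (C * enorm v)).
  - by rewrite mulr_ge0 ?enorm_ge0.
  - by move=> t; rewrite -mulrA (mulrC (enorm v)) -enormZ.
  move=> e e0; have N0 : 0 < enorm v + 1 by rewrite ltr_wpDl ?enorm_ge0.
  have [|d d0 h] := aA (e / (enorm v + 1)); first by rewrite divr_gt0.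
  exists (d / (enorm v + 1)); first by rewrite divr_gt0.
  move=> s t; rewrite ler_pdivlMr// => sd; rewrite scalerDl.
  apply: le_trans (h _ _ _) _.
    rewrite enormZ; apply: le_trans sd; apply: ler_wpM2l => //; lra.
  rewrite enormZ mulrAC ler_pdivrMr// mulrA; apply: ler_wpM2l; last lra.
  by rewrite mulr_ge0// ltW.
have lD v w : l (v + w) = l v + l w.
  apply: (has_slope_uniq (lP _)).
  have h0 : has_slope (fun t => a (t *: (v + w)) - a (t *: v) - a (t *: w)) 0.
    move=> e e0; have Nv : 0 < enorm v + 1 by rewrite ltr_wpDl ?enorm_ge0.
    have Nw : 0 < enorm w + 1 by rewrite ltr_wpDl ?enorm_ge0.
    have [|d d0 h] := aA (e / (enorm w + 1)); first by rewrite divr_gt0.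
    exists (d / (enorm v + 1)); first by rewrite divr_gt0.
    move=> t; rewrite ler_pdivlMr// => td; rewrite scalerDr mulr0 subr0.
    apply: le_trans (h _ _ _) _.
      rewrite enormZ; apply: le_trans td; apply: ler_wpM2l => //; lra.
    rewrite enormZ mulrAC ler_pdivrMr// mulrA; apply: ler_wpM2l; last lra.
    by rewrite mulr_ge0// ltW.
  have := has_slopeD (has_slopeD h0 (lP v)) (lP w); rewrite add0r.
  by congr has_slope; apply/funext => t /=; ring.
have lZ c v : l (c *: v) = c * l v.
  apply: (has_slope_uniq (lP _)).
  have := has_slope_scale c (lP v).
  by congr has_slope; apply/funext => t; rewrite scalerA.
have l0 : l 0 = 0 by rewrite -(scale0r 0) lZ mul0r.
exists (\row_j l (delta_mx 0 j)) => v.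
suff -> : dot (\row_j l (delta_mx 0 j)) v = l v by exact: lP.
rewrite [in RHS](row_sum_delta v) (big_morph l lD l0).
by apply: eq_bigr => j _; rewrite lZ mxE mulrC.
Qed.

End almost_additive.

(** * Integrals over translated balls and the derivative of the ball average *)

Section smoothing.
Context (R : realType) (k : nat).
Notation lam := (@rV_lebesgue R k).
Notation B := (@eball R k).
Implicit Types (f : 'rV[R]_k -> R) (v w : 'rV[R]_k).

Lemma bounded_integrable_rV f (A : set 'rV[R]_k) (C : R) : measurable A ->
  (lam A < +oo)%E -> measurable_fun setT f -> (forall u, A u -> `|f u| <= C) ->
  lam.-integrable A (EFin \o f).
Proof.
move=> mA Aoo mf fC; apply: measurable_bounded_integrable => //.
  exact: measurable_funTS.
exists C; split; first exact: num_real.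
by move=> M CM u Au; apply: le_trans (fC u Au) (ltW CM).
Qed.

Lemma Rintegral_bound f (A : set 'rV[R]_k) (C : R) : measurable A ->
  (lam A < +oo)%E -> measurable_fun setT f -> (forall u, A u -> `|f u| <= C) ->
  `|\int[lam]_(u in A) f u| <= C * fine (lam A).
Proof.
move=> mA Aoo mf fC.
have intf := bounded_integrable_rV mA Aoo mf fC.
apply: le_trans (le_normr_Rintegral mA intf) _.
rewrite -Rintegral_cst//; apply: le_Rintegral => //.
  apply: (bounded_integrable_rV (C := C)) => //; first exact: measurableT_comp.
  by move=> u Au; rewrite normr_id fC.
by apply: (bounded_integrable_rV (C := `|C|)) => //; exact: measurable_cst.
Qed.

Lemma measurable_shift_rV v : measurable_fun setT (fun u : 'rV[R]_k => u + v).
Proof.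
apply: measurable_fun_rV => j; under eq_fun do rewrite mxE.
by apply: measurable_funD => //; exact: measurable_coord.
Qed.

Lemma Rintegral_shift f (D : set 'rV[R]_k) v : measurable D ->
  measurable_fun setT f ->
  lam.-integrable [set u | D (u + v)] (fun u => (f (u + v))%:E) ->
  \int[lam]_(u in [set u | D (u + v)]) f (u + v) = \int[lam]_(u in D) f u.
Proof.
move=> mD mf intf; rewrite /Rintegral; congr fine.
have ms := measurable_shift_rV v.
rewrite -[LHS](@integral_pushforward _ _ _ _ R _ ms lam D (EFin \o f))//.
  by apply: eq_measure_integral => A mA _; rewrite -[RHS](rV_lebesgue_shift v).
exact: measurableT_comp.
Qed.

Lemma measurable_shift_set v (D : set 'rV[R]_k) : measurable D ->
  measurable [set u | D (u + v)].
Proof.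
by move=> mD; rewrite -[X in measurable X]setTI; exact: measurable_shift_rV.
Qed.

(* Translating the ball changes it only inside an annulus around the sphere,
   and the measure of that annulus is small. *)
Lemma Rintegral_eball_shift (e : R) : 0 < e -> exists2 dl : R, 0 < dl &
  forall f (C : R) v, measurable_fun setT f -> (forall u, `|f u| <= C) ->
    enorm v <= dl ->
    `|\int[lam]_(u in B) f (u + v) - \int[lam]_(u in B) f u| <= e * C.
Proof.
move=> e0; have e20 : 0 < e / 2 by rewrite divr_gt0.
have [dl dl0 h] := rV_lebesgue_annulus k e20; exists dl => // f C v mf fC vd.
have mB := @measurable_eball R k.
pose D := [set u | B (u - v)].
have mD : measurable D by exact: measurable_shift_set.
have BE : B = [set u | D (u + v)].
  by apply/seteqP; split=> u; rewrite /D/= addrK.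
have mfv : measurable_fun setT (fun u : 'rV[R]_k => f (u + v)).
  by apply: (measurableT_comp mf); exact: measurable_shift_rV.
have Boo := rV_lebesgue_eball_lty R k.
have Doo : (lam D < +oo)%E.
  apply: (@rV_lebesgue_bounded _ _ _ (1 + enorm v)) => // u; rewrite /D/= => uv.
  by rewrite -(subrK v u); apply: le_trans (enormD _ _) _; rewrite lerD2r.
have -> : \int[lam]_(u in B) f (u + v) = \int[lam]_(u in D) f u.
  rewrite {1}BE; apply: Rintegral_shift => //; rewrite -BE.
  exact: (bounded_integrable_rV (C := C)).
have split_int (X Y : set 'rV[R]_k) : measurable X -> measurable Y ->
    (lam X < +oo)%E ->
    \int[lam]_(u in X) f u = \int[lam]_(u in X `&` Y) f u + \int[lam]_(u in X `\` Y) f u.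
  move=> mX mY Xoo.
  have XE : X = (X `&` Y) `|` (X `\` Y) by rewrite setUIDK.
  rewrite {1}XE; apply: Rintegral_setU.
  - exact: measurableI.
  - exact: measurableD.
  - by rewrite -XE; exact: (bounded_integrable_rV (C := C)).
  - by apply/disj_setPS => u [[_ Yu] [_ nYu]].
have small (X : set 'rV[R]_k) : measurable X ->
    (forall u, X u -> `|enorm u - 1| <= dl) ->
    `|\int[lam]_(u in X) f u| <= C * (e / 2).
  move=> mX Xd; have Xe := h X mX Xd.
  have Xoo : (lam X < +oo)%E by exact: le_lt_trans Xe (ltry _).
  apply: le_trans (Rintegral_bound mX Xoo mf (fun u _ => fC u)) _.
  apply: ler_wpM2l; first exact: le_trans (normr_ge0 _) (fC 0).
  by rewrite -lee_fin fineK// ge0_fin_numE.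
rewrite (split_int D B)// (split_int B D)// (setIC B D).
rewrite opprD addrACA subrr add0r.
apply: le_trans (ler_normB _ _) _.
have -> : e * C = C * (e / 2) + C * (e / 2) by field.
apply: lerD; apply: small; try exact: measurableD.
- move=> u; rewrite /D/= => -[uv /negP]; rewrite -ltNge => u1.
  have := enormD (u - v) v; rewrite subrK /eball/= in uv *.
  by rewrite ler_norml; lra.
- move=> u; rewrite /D/= => -[u1 /negP]; rewrite -ltNge => uv.
  have := enormB u v; rewrite /eball/= in u1 *.
  by rewrite ler_norml; lra.
Qed.

Section lipschitz.
Variables (H : 'rV[R]_k -> R) (M : R).
Hypothesis HM : forall x y, `|H x - H y| <= M * enorm (x - y).

Let mH : measurable_fun setT H. Proof. exact: lipschitz_measurable HM. Qed.

Let mHv v : measurable_fun setT (fun u : 'rV[R]_k => H (u + v)).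
Proof. by apply: (measurableT_comp mH); exact: measurable_shift_rV. Qed.

Lemma lipschitz_integrable_eball v : lam.-integrable B (fun u => (H (u + v))%:E).
Proof.
apply: (bounded_integrable_rV (C := `|H 0| + `|M| * (1 + enorm v))) => //.
- exact: measurable_eball.
- exact: rV_lebesgue_eball_lty.
move=> u; rewrite /eball/= => u1.
rewrite -[H (u + v)](subrK (H 0)) addrC; apply: le_trans (ler_normD _ _) _.
rewrite lerD2l; apply: le_trans (HM _ _) _; rewrite subr0.
apply: le_trans (ler_wpM2r (enorm_ge0 _) (ler_norm M)) _.
by apply: ler_wpM2l => //; apply: le_trans (enormD _ _) _; rewrite lerD2r.
Qed.

Let Phi v := \int[lam]_(u in B) H (u + v).

(** The second difference of [Phi] along v and w compares the integrals of u |-> H(u + w) - H(u)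
    over the ball and over its translate by v. This integrand is at most |M| |w|, so a small v makes
    the second difference small relative to |w|. *)
Lemma eball_integral_slope : exists g, forall v,
  has_slope (fun t => Phi (t *: v) - Phi 0) (dot g v).
Proof.
have mB := @measurable_eball R k.
have intH := lipschitz_integrable_eball.
have diffE v w : Phi (v + w) - Phi v =
    \int[lam]_(u in B) (H (u + v + w) - H (u + v)).
  rewrite /Phi -RintegralB//; first by apply: eq_Rintegral => u _; rewrite addrA.
    exact: intH.
  exact: intH.
have gM w u : `|H (u + w) - H u| <= `|M| * enorm w.
  apply: le_trans (HM _ _) _; rewrite [u + w]addrC addrK.
  by apply: ler_wpM2r; [exact: enorm_ge0|exact: ler_norm].
have mg w : measurable_fun setT (fun u : 'rV[R]_k => H (u + w) - H u).
  by apply: measurable_funB => //; exact: mHv.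
apply: (@almost_additive_linear _ _ (fun v => Phi v - Phi 0)
  (`|M| * fine (lam B))).
- by rewrite mulr_ge0// fine_ge0.
- move=> v; rewrite -[X in Phi X - _]add0r diffE.
  rewrite mulrAC; apply: Rintegral_bound => //; first exact: rV_lebesgue_eball_lty.
    by under eq_fun do rewrite addr0; exact: mg.
- move=> e e0; have M0 : 0 < `|M| + 1 by rewrite ltr_wpDl.
  have [|dl dl0 h] := @Rintegral_eball_shift (e / (`|M| + 1)).
    by rewrite divr_gt0.
  exists dl => // v w vd.
  have -> : Phi (v + w) - Phi 0 - (Phi v - Phi 0) - (Phi w - Phi 0) =
      (Phi (v + w) - Phi v) - (Phi (0 + w) - Phi 0) by rewrite add0r; ring.
  rewrite !diffE; under [X in _ - X]eq_Rintegral do rewrite addr0.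
  apply: le_trans (h _ _ _ (mg w) (gM w) vd) _.
  rewrite mulrA; apply: ler_wpM2r; first exact: enorm_ge0.
  rewrite mulrAC ler_pdivrMr//; apply: ler_wpM2l; [exact: ltW|lra].
Qed.

End lipschitz.

Lemma ball_meanE f : ball_mean f = (\int[lam]_(u in B) f u) / fine (lam B).
Proof. by rewrite /ball_mean /Rintegral -rV_lebesgueE. Qed.

Lemma eq_ball_mean f g : {in B, f =1 g} -> ball_mean f = ball_mean g.
Proof. by move=> fg; rewrite !ball_meanE (eq_Rintegral _ fg). Qed.

(** [H] carries the global regularity that integration uses; [h] agrees with it only on a slightly
    larger ball, enough for small displacements of the centre. In the last clause dl' is the same
    for all y, because the quotients are averaged at a fixed t. *)
Lemma ball_mean_gradient (h H : 'rV[R]_k -> R) (M : R) (x : 'rV[R]_k) (eta dl : R) :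
  0 < eta -> 0 < dl -> (forall y z, `|H y - H z| <= M * enorm (y - z)) ->
  (forall y, enorm (y - x) <= eta + dl -> h y = H y) ->
  exists g, (forall d : 'rV[R]_k, is_derive x d
      (fun z => ball_mean (fun u => h (z + eta *: u))) (dot g d)) /\
    forall (d : 'rV[R]_k) (c dl' : R), 0 < dl' ->
      (forall (y : 'rV[R]_k) (t : R), enorm (y - x) <= eta -> 0 < t -> t < dl' ->
         h (y + t *: d) - h y <= c * t) ->
      dot g d <= c.
Proof.
move=> eta0 dl0 HM hH.
pose K (u : 'rV[R]_k) := H (x + eta *: u).
have KM y z : `|K y - K z| <= (M * eta) * enorm (y - z).
  apply: le_trans (HM _ _) _; rewrite opprD addrACA subrr add0r -scalerBr enormZ.
  by rewrite (gtr0_norm eta0) mulrA.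
have [g0 g0P] := eball_integral_slope KM.
pose c0 := fine (lam B).
have c00 : 0 < c0.
  by apply: fine_gt0; rewrite rV_lebesgue_eball_gt0 rV_lebesgue_eball_lty.
(* 1 / c0 normalises the volume; 1 / eta is the chain rule, a shift of the centre by v being a shift
   of u by v / eta. *)
pose g := (c0 * eta)^-1 *: g0.
pose S (z : 'rV[R]_k) := ball_mean (fun u => h (z + eta *: u)).
have SE v : enorm v <= dl -> S (x + v) = (\int[lam]_(u in B) K (u + eta^-1 *: v)) / c0.
  move=> vd; rewrite /S -ball_meanE; apply: eq_ball_mean => u; rewrite inE => uB.
  rewrite /K scalerDr scalerA divff ?gt_eqF// scale1r.
  have yx : x + v + eta *: u - x = eta *: u + v.
    by rewrite addrAC [x + v]addrC addrK addrC.
  rewrite hH; first by rewrite -addrA (addrC v).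
  rewrite yx; apply: le_trans (enormD _ _) _; rewrite enormZ (gtr0_norm eta0).
  by apply: lerD => //; rewrite -[leRHS]mulr1 ler_pM2l.
have S0 : S x = (\int[lam]_(u in B) K (u + 0)) / c0.
  by have := SE 0; rewrite addr0 scaler0 enorm0; apply; exact: ltW.
have slope (d : 'rV[R]_k) : has_slope (fun t => S (x + t *: d) - S x) (dot g d).
  move=> e e0; have ed : 0 < enorm d + 1 by rewrite ltr_wpDl ?enorm_ge0.
  have [|d1 d10 h1] := g0P (eta^-1 *: d) (e * c0); first by rewrite mulr_gt0.
  exists (Num.min d1 (dl / (enorm d + 1))); first by rewrite lt_min d10 divr_gt0.
  move=> t; rewrite le_min ler_pdivlMr// => /andP[td1 td2].
  have td : enorm (t *: d) <= dl.
    by rewrite enormZ; apply: le_trans td2; apply: ler_wpM2l => //; lra.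
  rewrite S0 SE//.
  have := h1 t td1; rewrite scalerA (mulrC t) -scalerA => h2.
  have -> : dot g d = dot g0 (eta^-1 *: d) / c0.
    by rewrite /g !dotE invfM; ring.
  rewrite mulrA -!mulrBl normrM normfV (gtr0_norm c00) ler_pdivrMr//.
  by rewrite mulrAC.
exists g; split=> [d|d c d2 d20 hd]; first exact: (has_slope_derive (slope d)).
apply/ler_addgt0Pr => e e0; have [d1 d10 h1] := slope d _ e0.
have ed : 0 < enorm d + 1 by rewrite ltr_wpDl ?enorm_ge0.
(* The three terms ensure, in order, accuracy of the slope, t < d2, and displacements on which [h]
   and [H] still agree. *)
pose t := Num.min d1 (Num.min (d2 / 2) (dl / (enorm d + 1))).
have t0 : 0 < t by rewrite !lt_min d10 !divr_gt0.
have [td1 td2 td3] : [/\ t <= d1, t <= d2 / 2 & t <= dl / (enorm d + 1)].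
  by rewrite /t !ge_min !lexx ?orbT.
have td : enorm (t *: d) <= dl.
  rewrite enormZ (gtr0_norm t0); rewrite ler_pdivlMr// in td3.
  by apply: le_trans td3; apply: ler_wpM2l; [exact: ltW|lra].
have := h1 t; rewrite (gtr0_norm t0) => /(_ td1).
have St : S (x + t *: d) - S x <= c * t.
  rewrite S0 SE//.
  rewrite -mulrBl ler_pdivrMr// -Rintegral_cst; last exact: measurable_eball.
  rewrite -RintegralB; last 3 first.
  - exact: measurable_eball.
  - exact: lipschitz_integrable_eball KM _.
  - exact: lipschitz_integrable_eball KM _.
  apply: le_Rintegral; first exact: measurable_eball.
  - exact: (integrableB (@measurable_eball R k)
      (lipschitz_integrable_eball KM (eta^-1 *: (t *: d)))
      (lipschitz_integrable_eball KM 0)).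
  - apply: (bounded_integrable_rV (C := `|c * t|)) => //.
      exact: measurable_eball.
    exact: rV_lebesgue_eball_lty.
  move=> u; rewrite /eball/= => u1; rewrite /K addr0.
  have yx : enorm (x + eta *: u - x) <= eta.
    by rewrite addrAC subrr add0r enormZ (gtr0_norm eta0) -[leRHS]mulr1 ler_pM2l.
  have := hd _ t yx t0 _; rewrite !hH; last 2 first.
  - by apply: le_trans yx _; rewrite lerDl ltW.
  - by rewrite addrAC; apply: le_trans (enormD _ _) _; exact: lerD yx td.
  rewrite scalerDr scalerA divff ?gt_eqF// scale1r addrA; apply; lra.
rewrite ler_norml => /andP[+ _] => h2.
rewrite -(ler_pM2l t0) mulrDr; have := mulrC c t; have := mulrC e t; lra.
Qed.

End smoothing.

(** * Gradient of the smoothing and Clarke subdifferential *)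

Section lipschitz_extension.
Context (R : realType) (k : nat).
Implicit Types (g : 'rV[R]_k -> R) (A K : set 'rV[R]_k) (x y z : 'rV[R]_k).

(* McShane's extension. *)
Lemma lipschitz_extension A g (M : R) : A !=set0 -> 0 <= M ->
  (forall y z, A y -> A z -> `|g y - g z| <= M * enorm (y - z)) ->
  exists2 H : 'rV[R]_k -> R, (forall y z, `|H y - H z| <= M * enorm (y - z)) &
    forall y, A y -> H y = g y.
Proof.
move=> [a Aa] M0 gM.
pose F y := [set g z + M * enorm (y - z) | z in A].
have F0 y : F y !=set0 by exists (g a + M * enorm (y - a)); exists a.
have Flb y r : F y r -> g a - M * enorm (y - a) <= r.
  move=> [z Az <-]; have := gM a z Aa Az; rewrite ler_norml => /andP[_].
  have := enorm_distD y a z; rewrite (enorm_distC a y) => az.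
  have := ler_wpM2l M0 az; rewrite mulrDr; lra.
have Fle y z : A z -> inf (F y) <= g z + M * enorm (y - z).
  move=> Az; apply: ge_inf; last by exists z.
  by exists (g a - M * enorm (y - a)) => r; exact: Flb.
exists (fun y => inf (F y)).
  have half y z : inf (F y) - inf (F z) <= M * enorm (y - z).
    rewrite lerBlDr -lerBlDl; apply: lb_le_inf => // _ [u Au <-].
    have := Fle y u Au; have := ler_wpM2l M0 (enorm_distD z y u).
    rewrite mulrDr; lra.
  move=> y z; rewrite ler_norml half andbT.
  by have := half z y; rewrite (enorm_distC z y); lra.
move=> y Ay; apply/eqP; rewrite eq_le; apply/andP; split.
  by have := Fle y y Ay; rewrite subrr enorm0 mulr0 addr0.
apply: lb_le_inf => // _ [z Az <-].
by have := gM y z Ay Az; rewrite ler_norml => /andP[]; lra.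
Qed.

(** Each point of [K] controls all nearby points and all small parameters, so a finite subcover
    leaves a parameter valid on the whole of [K]. *)
Lemma compact_uniform K (P : R -> 'rV[R]_k -> Prop) : compact K ->
  (forall x, K x -> exists2 dl : R, 0 < dl &
     forall (e : R) y, 0 < e -> e < dl -> enorm (y - x) < dl -> P e y) ->
  exists2 dl : R, 0 < dl & forall x, K x -> P dl x.
Proof.
move=> /compact_near_coveringP cK hK.
have FF : Filter (at_right (0 : R)) by exact: within_filter.
have := cK R (at_right 0) P FF.
have h : forall x, K x -> \forall x' \near x & i \near at_right (0 : R), P i x'.
  move=> x Kx; have [dl dl0 h] := hK x Kx.
  exists ([set y | enorm (y - x) < dl], [set t | 0 < t < dl]).
    split => /=.
      have /cvgr_lt := @continuous_enormB _ _ x x; rewrite subrr enorm0 => /(_ _ dl0); exact.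
    near=> t; apply/andP; split.
      by near: t; exact: nbhs_right_gt.
    by near: t; exact: nbhs_right_lt.
  by move=> [y t] /= [yx /andP[t0 td]]; exact: h.
move=> /(_ h) hn.
have : \forall t \near at_right (0 : R), 0 < t /\ (forall x, K x -> P t x).
  near=> t; split; first by near: t; exact: nbhs_right_gt.
  by near: t; exact: hn.
by move=> /filter_ex[t [t0 ht]]; exists t.
Unshelve. all: by end_near. Qed.

Lemma closed_ball_compact x (r : R) : compact [set y | enorm (y - x) <= r].
Proof.
apply: (@compact_eball _ _ _ (r + enorm x)).
  apply: (@preimage_closed _ _ (fun y => enorm (y - x)) [set t | t <= r]).
    by move=> v _; exact: continuous_enormB.
  exact: closed_le.
move=> y /= yx; rewrite -(subrK x y); apply: le_trans (enormD _ _) _.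
by rewrite lerD2r.
Qed.

(** Cut the segment into pieces shorter than [r]: lengths add up along it, so the constant is
    unchanged. The induction removes the first 1 / (n + 1) of the segment. *)
Lemma lipschitz_chain A g (M r : R) : 0 < r ->
  (forall y z (t : R), A y -> A z -> 0 <= t <= 1 -> A (y + t *: (z - y))) ->
  (forall y z, A y -> A z -> enorm (y - z) < r -> `|g y - g z| <= M * enorm (y - z)) ->
  forall y z, A y -> A z -> `|g y - g z| <= M * enorm (y - z).
Proof.
move=> r0 cA h.
have main (n : nat) : forall y z, A y -> A z -> enorm (y - z) < n%:R * r ->
    `|g y - g z| <= M * enorm (y - z).
  elim: n => [|n IH] y z Ay Az; first by rewrite mul0r ltNge enorm_ge0.
  have [->|n0] := eqVneq n 0%N; first by rewrite mul1r; exact: h.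
  move=> yz; pose c : R := n.+1%:R^-1.
  have n10 : 0 < n.+1%:R :> R by rewrite ltr0n.
  have c0 : 0 < c by rewrite invr_gt0.
  have c1 : c <= 1 by rewrite invf_le1// ler1n.
  pose m := y + c *: (z - y).
  have Am : A m by apply: cA => //; rewrite c1 ltW.
  have ym : enorm (y - m) = c * enorm (y - z).
    by rewrite /m opprD addrA subrr add0r enormN enormZ gtr0_norm// enorm_distC.
  have mz : enorm (m - z) = (1 - c) * enorm (y - z).
    have -> : m - z = (1 - c) *: (y - z).
      by apply/rowP => j; rewrite !mxE; ring.
    by rewrite enormZ ger0_norm// subr_ge0.
  have cn : c * n.+1%:R = 1 by rewrite mulVf// gt_eqF.
  have ymr : enorm (y - m) < r.
    by rewrite ym -[ltRHS]mul1r -cn -mulrA ltr_pM2l.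
  have mzr : enorm (m - z) < n%:R * r.
    rewrite mz; have [->|c1'] := eqVneq c 1.
      by rewrite subrr mul0r mulr_gt0// ltr0n lt0n.
    have -> : n%:R * r = (1 - c) * (n.+1%:R * r).
      by rewrite mulrA mulrBl mul1r cn -natr1 addrK.
    by rewrite ltr_pM2l// subr_gt0 lt_def eq_sym c1' c1.
  have := lerD (h y m Ay Am ymr) (IH m z Am Az mzr).
  rewrite ym mz => h2; apply: le_trans (ler_distD (g m) _ _) _.
  by apply: le_trans h2 _; rewrite -mulrDr -mulrDl addrC subrK mul1r.
move=> y z Ay Az.
have [n hn] : exists n : nat, enorm (y - z) < n%:R * r.
  exists (Num.truncn (enorm (y - z) / r)).+1; rewrite -ltr_pdivrMr//.
  exact: truncnS_gt.
exact: main hn.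
Qed.

End lipschitz_extension.

Section smoothed_gradient.
Context (R : realType) (k : nat).
Implicit Types (h : 'rV[R]_k -> R) (x y z d : 'rV[R]_k).

Lemma lipschitz_near_ball h x (eta : R) : 0 < eta ->
  (forall z, enorm (z - x) <= eta -> lipschitz_near h z) ->
  exists2 dl : R, 0 < dl & exists2 M, 0 <= M & forall y z,
    enorm (y - x) <= eta + dl -> enorm (z - x) <= eta + dl ->
    `|h y - h z| <= M * enorm (y - z).
Proof.
move=> eta0 hn.
pose K := [set y | enorm (y - x) <= eta].
(* The single parameter e encodes both a radius and, as 1 / e, a Lipschitz constant; shrinking e
   weakens both requirements. *)
pose P (e : R) z := forall y y', enorm (y - z) < e -> enorm (y' - z) < e ->
  `|h y - h y'| <= e^-1 * enorm (y - y').
have [|dl dl0 hdl] := @compact_uniform _ _ K P (@closed_ball_compact _ _ x eta).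
  move=> z Kz; have [M [d d0 hd]] := hn z Kz.
  have M0 : 0 < `|M| + 1 by rewrite ltr_wpDl.
  exists (Num.min (d / 2) (`|M| + 1)^-1).
    by rewrite lt_min divr_gt0// invr_gt0.
  move=> e z' e0; rewrite !lt_min => /andP[ed eM] /andP[z'z _] y y' yz' y'z'.
  apply: le_trans (hd y y' _ _) _.
  - by apply: le_lt_trans (enorm_distD z' _ _) _; lra.
  - by apply: le_lt_trans (enorm_distD z' _ _) _; lra.
  apply: ler_wpM2r; first exact: enorm_ge0.
  apply: le_trans (ler_norm M) _; apply: le_trans (_ : `|M| + 1 <= _); first lra.
  by rewrite -[leLHS]invrK lef_pV2 ?posrE ?invr_gt0// ltW.
exists (dl / 4); first by rewrite divr_gt0.
exists dl^-1; first by rewrite invr_ge0 ltW.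
apply: (@lipschitz_chain _ _ [set y | enorm (y - x) <= eta + dl / 4] h _ (dl / 2)).
- by rewrite divr_gt0.
- move=> y z t /= yx zx /andP[t0 t1].
  have -> : y + t *: (z - y) - x = (1 - t) *: (y - x) + t *: (z - x).
    by apply/rowP => j; rewrite !mxE; ring.
  apply: le_trans (enormD _ _) _; rewrite !enormZ (ger0_norm t0) ger0_norm ?subr_ge0//.
  have -> : eta + dl / 4 = (1 - t) * (eta + dl / 4) + t * (eta + dl / 4) by ring.
  by apply: lerD; apply: ler_wpM2l => //; rewrite subr_ge0.
move=> y z /= yx zx yz.
(* p is the radial projection of y on the closed ball. As y is within dl / 4 of p and z within dl /
   2 of y, both lie within dl of p. *)
have [p Kp yp] : exists2 p, K p & enorm (y - p) <= dl / 4.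
  have [yK|ynK] := leP (enorm (y - x)) eta.
    by exists y => //; rewrite subrr enorm0 divr_ge0// ltW.
  have N0 : 0 < enorm (y - x) by exact: lt_trans ynK.
  pose c := eta / enorm (y - x).
  have c0 : 0 < c by rewrite divr_gt0.
  have cN : c * enorm (y - x) = eta by rewrite divfK// gt_eqF.
  have c1 : c <= 1 by rewrite ler_pdivrMr// mul1r ltW.
  exists (x + c *: (y - x)).
    by rewrite /K/= addrAC subrr add0r enormZ gtr0_norm// cN.
  have -> : y - (x + c *: (y - x)) = (1 - c) *: (y - x).
    by apply/rowP => j; rewrite !mxE; ring.
  by rewrite enormZ ger0_norm ?subr_ge0// mulrBl mul1r cN; lra.
apply: (hdl p Kp); first lra.
apply: le_lt_trans (enorm_distD y _ _) _; rewrite (enorm_distC z y); lra.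
Qed.

Lemma clarke_le_lipschitz h x (M dl : R) v : 0 <= M -> 0 < dl ->
  (forall y z, enorm (y - x) < dl -> enorm (z - x) < dl ->
    `|h y - h z| <= M * enorm (y - z)) ->
  clarke h x v -> enorm v <= M.
Proof.
move=> M0 dl0 hM /clarkeP hv.
have := hv v _ (lipschitz_clarke_le dl0 hM v).1; rewrite -enormE expr2.
have [->//|v0] := eqVneq (enorm v) 0.
by rewrite ler_pM2r// lt_def v0 enorm_ge0.
Qed.

Lemma smoothed_gradient_near_clarke h x (eta L M : R) : 0 < eta -> 0 <= M ->
  (forall y z, enorm (y - x) <= eta -> enorm (z - x) <= eta ->
    `|h y - h z| <= M * enorm (y - z)) ->
  set_lipschitz L [set y | enorm (y - x) <= eta] (clarke h) ->
  exists g, (forall d, is_derive x d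
      (fun z => ball_mean (fun u => h (z + eta *: u))) (dot g d)) /\
    exists2 s, clarke h x s & enorm (g - s) <= eta * `|L|.
Proof.
move=> eta0 M0 hM hL.
have xx : enorm (x - x) <= eta by rewrite subrr enorm0 ltW.
have hM' y z : enorm (y - x) < eta -> enorm (z - x) < eta ->
    `|h y - h z| <= M * enorm (y - z).
  by move=> /ltW yx /ltW zx; exact: hM.
have nx : lipschitz_near h x by exists M, eta.
have [v0 hv0 _] := clarke_support 0 nx.
have bx v : clarke h x v -> enorm v <= M by exact: clarke_le_lipschitz eta0 hM'.
(* The absolute value appears because no sign is assumed for [L]; the unit ball is symmetric. *)
have transfer y z v : enorm (y - x) <= eta -> enorm (z - x) <= eta ->
    clarke h y v -> exists2 w, clarke h z w & enorm (v - w) <= `|L| * enorm (y - z).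
  move=> yx zx hv; have [w hw [b b1 <-]] := hL y z yx zx v hv.
  exists w => //; rewrite [w + _]addrC addrK enormZ normrM (ger0_norm (enorm_ge0 _)).
  by rewrite -[leRHS]mulr1 ler_wpM2l// mulr_ge0// enorm_ge0.
have near z : enorm (z - x) <= eta -> lipschitz_near h z.
  move=> zx; have [w hw _] := transfer x z v0 xx zx hv0.
  apply: clarke_finite_lipschitz_near.
  apply: (@clarke_bounded_finite _ _ _ _ w (M + `|L| * eta)) => // v hv.
  have [u hu vu] := transfer z x v zx xx hv.
  rewrite -(subrK u v); apply: le_trans (enormD _ _) _; rewrite addrC.
  apply: lerD; first exact: bx.
  by apply: le_trans vu _; apply: ler_wpM2l.
have [dl dl0 [M' M'0 hK]] := lipschitz_near_ball eta0 near.
have [|H HM HE] := @lipschitz_extension _ _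
    [set y | enorm (y - x) <= eta + dl] h M' _ M'0 hK.
  by exists x => /=; rewrite subrr enorm0 addr_ge0 ?ltW.
have [g [gd gle]] := ball_mean_gradient eta0 dl0 HM (fun y yx => esym (HE y yx)).
exists g; split=> //.
have bound d v : clarke h x v -> clarke_le h x d (dot v d) ->
    dot g d <= dot v d + eta * `|L| * enorm d.
  move=> hv vd; apply/ler_addgt0Pr => e e0.
  set c := dot v d + _.
  (* The slack e allows strict Clarke bounds, each valid near one base point; compactness turns them
     into a bound on quotients over the whole ball, ready to be averaged. *)
  pose P (r : R) z := forall y (t : R), enorm (y - z) < r -> 0 < t -> t < r ->
    h (y + t *: d) - h y <= (c + e) * t.
  have [|r r0 hr] := @compact_uniform _ _ [set y | enorm (y - x) <= eta] P
      (@closed_ball_compact _ _ x eta).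
    move=> z zx; have [w hw wd] := clarke_support d (near z zx).
    have [u hu wu] := transfer z x w zx xx hw.
    have wc : dot w d <= c.
      have -> : dot w d = dot u d + dot (w - u) d by rewrite !dotE; ring.
      apply: lerD.
        by have /clarkeP h1 := hu; exact: h1.
      apply: le_trans (dot_le _ _) _; apply: ler_wpM2r; first exact: enorm_ge0.
      by apply: le_trans wu _; rewrite mulrC; apply: ler_wpM2r.
    have [|r r0 hr] := clarke_leW wc wd (_ : c < c + e); first by rewrite ltrDl.
    exists (r / 2); first by rewrite divr_gt0.
    move=> e' z' e'0 e'r z'z y t yz' t0 te'; apply: hr => //; last lra.
    apply: le_lt_trans (enorm_distD z' _ _) _; lra.
  apply: (gle d (c + e) r r0) => y t yx t0 tr.
  by apply: (hr y yx) => //; rewrite subrr enorm0.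
(* With [v] attaining the Clarke derivative in the direction g - s, the obtuse angle at [s] gives
   <v, g - s> <= <s, g - s>. The bound then reads |g - s|^2 <= eta |L| |g - s|. *)
have [s hs smin] := exists_closest g (ex_intro _ v0 hv0) (@clarke_closed _ _ h x).
exists s => //.
have obt := closest_obtuse (fun y t hy => clarke_convex hs hy) smin.
have [v hv vd] := clarke_support (g - s) nx.
have := bound _ _ hv vd; have := obt v hv; rewrite dotC => ob h1.
have : enorm (g - s) * enorm (g - s) <= eta * `|L| * enorm (g - s).
  rewrite -expr2 enormE.
  have -> : dot (g - s) (g - s) = dot g (g - s) - dot s (g - s) by rewrite dotDl dotNl.
  by move: ob; rewrite dotDl dotNl; lra.
have [->|gs0] := eqVneq (enorm (g - s)) 0; first by rewrite mulr_ge0// ltW.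
by rewrite ler_pM2r// lt_def gs0 enorm_ge0.
Qed.

End smoothed_gradient.

(** * The game *)

Section lower_integral.
Local Open Scope ereal_scope.
Context d (T : measurableType d) (R : realType).
Import HBNNSimple.

Lemma ge0_le_integral_nonmeasurable (mu : {measure set T -> \bar R})
    (f g : T -> \bar R) :
  (forall x, 0 <= f x) -> (forall x, f x <= g x) ->
  \int[mu]_x f x <= \int[mu]_x g x.
Proof.
move=> f0 fg; have g0 x : 0 <= g x by exact: le_trans (f0 x) (fg x).
rewrite !ge0_integralTE//; apply: ge_ereal_sup => _ [h hf <-].
by apply: ereal_sup_ubound; exists h => // x; exact: le_trans (hf x) (fg x).
Qed.

(* The library integral of a nonnegative function is a lower integral, so this
   needs no measurability: compare the simple functions below f with c + 2 g. *)
Lemma lower_integral_affine (P : probability T R) (f g : T -> R) (c : R) :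
  (0 <= c)%R -> (forall x, 0 <= f x)%R -> (forall x, 0 <= g x)%R ->
  (forall x, f x <= c + 2 * g x)%R ->
  \int[P]_x (f x)%:E <= c%:E + 2%:E * \int[P]_x (g x)%:E.
Proof.
move=> c0 f0 g0 fg.
rewrite ge0_integralTE; last by move=> x; rewrite lee_fin.
apply: ge_ereal_sup => _ [h hf <-]; rewrite -integralT_nnsfun.
(* A measurable function squeezed between: h <= c + 2 phi and phi <= g. Additivity of the integral
   is applied to [phi] only. *)
pose phi x : R := (Num.max (h x - c) 0 / 2)%R.
have phi0 x : (0 <= phi x)%R by rewrite divr_ge0// le_max lexx orbT.
have mphi : measurable_fun setT phi.
  apply: measurable_funM => //; apply: measurable_maxr => //.
  by apply: measurable_funB.
apply: (@le_trans _ _ (\int[P]_x (c%:E + 2%:E * (phi x)%:E))).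
  apply: ge0_le_integral_nonmeasurable => x; first by rewrite lee_fin.
  rewrite -EFinM -EFinD lee_fin /phi mulrC divfK// -lerBlDl.
  by rewrite le_max lexx.
have m2phi : measurable_fun setT (EFin \o phi) by exact/measurable_EFinP.
rewrite ge0_integralD//; last 2 first.
- by move=> x _; rewrite -EFinM lee_fin mulr_ge0.
- by under eq_fun do rewrite -EFinM; apply/measurable_EFinP/measurable_funM.
have -> : \int[P]_(x in setT) c%:E = c%:E.
  by rewrite integral_cst// -[RHS]mule1; congr (_ * _); exact: probability_setT.
rewrite leeD2l//.
rewrite ge0_integralZl//; last first.
  by move=> x _; rewrite lee_fin.
apply: lee_wpmul2l => //; apply: ge0_le_integral_nonmeasurable => x.
  by rewrite lee_fin.
rewrite lee_fin /phi ler_pdivrMr// ge_max mulr_ge0// andbT.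
rewrite lerBlDl mulrC; apply: le_trans (fg x).
by have := hf x; rewrite lee_fin.
Qed.

End lower_integral.

Section blocks.
Context (R : realType) (N : nat) (n : 'I_N -> nat).
Implicit Types (x y v : 'rV[R]_(\sum_i n i)).

Lemma enorm_mxrow (v : forall i, 'rV[R]_(n i)) :
  enorm (\mxrow_i v i) ^+ 2 = \sum_i enorm (v i) ^+ 2.
Proof.
have dotM k (u w : 'rV[R]_k) : dot u w = (u *m w^T) 0 0.
  by rewrite mxE; apply: eq_bigr => j _; rewrite mxE.
rewrite enormE dotM tr_mxrow mul_mxrow_mxcol summxE.
by apply: eq_bigr => i _; rewrite enormE dotM.
Qed.

Lemma submxrow_repl x i (z : 'rV[R]_(n i)) : submxrow (repl x z) i = z.
Proof. by rewrite /repl mxrowK dfwithin. Qed.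

Lemma continuous_submxrow i :
  continuous (fun x : 'rV[R]_(\sum_i n i) => submxrow x i).
Proof.
move=> x; apply/(@cvgrPdist_le _ _ _ _ (nbhs_filter x)) => e e0.
near=> y; apply: le_trans (_ : `|x - y| <= e).
  rewrite [leLHS]/Num.norm/= mx_normrE; apply/bigmax_leP; split => //.
  move=> [a j] _ /=; rewrite ord1.
  by have := norm_coord (x - y) (tagnat.Rank i j); rewrite !mxE.
by near: y; apply: (@cvgr_dist_le _ _ _ (nbhs x) _ id x).
Unshelve. all: by end_near. Qed.

End blocks.

Section eucl_dist.
Context (R : realType).

Lemma eucl_dist_ge0 k (x : 'rV[R]_k) A : 0 <= eucl_dist x A.
Proof.
have [->|/set0P[a Aa]] := eqVneq A set0.
  by rewrite /eucl_dist image_set0 inf0.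
apply: lb_le_inf; first by exists (enorm (a - x)), a.
by move=> _ [y _ <-]; exact: enorm_ge0.
Qed.

(** Origin of both factors 2 in the final estimate. *)
Lemma sqrrD_le2 (a b : R) : (a + b) ^+ 2 <= 2 * a ^+ 2 + 2 * b ^+ 2.
Proof. by have := sqr_ge0 (a - b); rewrite sqrrB sqrrD; lra. Qed.

End eucl_dist.

Section game.
Context (R : realType) (d : measure_display) (Om : measurableType d)
  (Pr : probability Om R) (N q : nat) (n : 'I_N -> nat) (G : game Pr q n)
  (L : 'I_N -> R) (eta : R).
Hypotheses (eta0 : 0 < eta) (gameG : lipschitz_game G L eta).
Local Notation X := (profiles G).

Lemma profiles_nonempty : X !=set0.
Proof.
exists (\mxrow_i projT1 (cid (strat_nonempty gameG i))) => i.
by rewrite mxrowK; exact: (projT2 (cid (strat_nonempty gameG i))).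
Qed.

Lemma profiles_closed : closed X.
Proof.
rewrite (_ : X = \bigcap_(i in setT)
    (fun x : 'rV[R]_(\sum_i n i) => submxrow x i) @^-1` strat G i).
  apply: closed_bigI => i _; apply: preimage_closed.
    by move=> x _; exact: continuous_submxrow.
  exact: strat_closed gameG i.
by apply/seteqP; split=> x /= h i => [_|]; [exact: h|exact: (h i I)].
Qed.

Lemma profiles_convex : convex_set X.
Proof.
move=> x y t; rewrite !inE => Xx Xy i.
have := strat_convex gameG t (mem_set (Xx i)) (mem_set (Xy i)).
rewrite inE; congr (strat G i); apply/rowP => j.
by rewrite /conv/= !mxE.
Qed.

Lemma enlarge_ball i z y : strat G i z -> enorm (y - z) <= eta ->
  enlarge (strat G i) eta y.
Proof.
move=> Xz yz; exists z => //; exists (eta^-1 *: (y - z)).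
  by rewrite /eball/= enormZ normfV gtr0_norm// ler_pdivrMl// mulr1.
by rewrite scalerA divff ?gt_eqF// scale1r addrC subrK.
Qed.

Lemma hbar_lipschitz i y z : enlarge (strat G i) eta y ->
  enlarge (strat G i) eta z -> `|hbar G i y - hbar G i z| <= `|L i| * enorm (y - z).
Proof.
move=> Xy Xz; rewrite /hbar unlock.
have iy := hs_integrable gameG Xy; have iz := hs_integrable gameG Xz.
have := @RintegralB _ _ _ Pr setT _ _ measurableT iy iz.
rewrite /Rintegral => <-.
have iyz := integrableB measurableT iy iz.
apply: le_trans (le_normr_Rintegral measurableT iyz) _.
have -> : `|L i| * enorm (y - z) =
    \int[Pr]_(w in setT) (`|L i| * enorm (y - z)).
  have P1 : fine (Pr setT) = 1 by rewrite probability_setT.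
  by rewrite Rintegral_cst// -[LHS]mulr1; congr (_ * _); exact: esym P1.
apply: le_Rintegral => //.
- exact: integrable_norm.
- exact: finite_measure_integrable_cst.
move=> w _; apply: le_trans (hs_lipschitz gameG (xi G w) Xy Xz) _.
by apply: ler_wpM2r; [exact: enorm_ge0|exact: ler_norm].
Qed.

Variable Lhat : 'I_N -> R.
Hypothesis hLhat : forall i,
  set_lipschitz (Lhat i) (enlarge (strat G i) eta) (clarke (hbar G i)).

Lemma pgrad_cost_eta_near_clarke x i : X x -> exists2 s,
  clarke (hbar G i) (submxrow x i) s &
  enorm (pgrad i (cost_eta G eta i) x - (s + pgrad i (mbar G i) x)) <=
    eta * `|Lhat i|.
Proof.
move=> Xx; set z := submxrow x i.
have ball_in y : enorm (y - z) <= eta -> enlarge (strat G i) eta y.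
  exact: enlarge_ball (Xx i).
have [g [gd [s hs gs]]] := @smoothed_gradient_near_clarke R (n i) (hbar G i) z
  eta (Lhat i) `|L i| eta0 (normr_ge0 _)
  (fun y y' hy hy' => hbar_lipschitz (ball_in y hy) (ball_in y' hy'))
  (fun y y' hy hy' => hLhat (ball_in y hy) (ball_in y' hy')).
exists s => //; rewrite (_ : _ - _ = g - s)//.
suff -> : pgrad i (cost_eta G eta i) x = g + pgrad i (mbar G i) x.
  by rewrite opprD addrACA subrr addr0.
(* The smooth part [mbar] contributes the same partial derivatives to both sides, so only the
   derivative of the ball average remains. *)
apply/rowP => j; rewrite /pgrad /grad !mxE.
have -> : (fun z => cost_eta G eta i (repl x z)) =
    (fun z => ball_mean (fun u => hbar G i (z + eta *: u))) +
    (fun z => mbar G i (repl x z)).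
  by apply/funext => y; rewrite /cost_eta submxrow_repl.
have gj := gd (delta_mx 0 j).
rewrite deriveD; first by rewrite derive_val dot_delta.
  exact: ex_derive.
exact/diff_derivable/(m_differentiable gameG).
Qed.

(** One near-optimal subgradient per player yields a single element [p] of the set-valued residual.
    The factor 1 / gamma outside the projection cancels the gamma inside, so |p - G_eta| <= |F_eta -
    v| whatever the stepsize. *)
Lemma residual_bound x (gamma : R) : X x -> 0 < gamma ->
  eucl_dist 0 (G_clarke G gamma x) ^+ 2 <=
    2 * eta ^+ 2 * (\sum_i Lhat i ^+ 2) + 2 * enorm (G_eta G eta gamma x) ^+ 2.
Proof.
move=> Xx gamma0.
pose sP i := cid2 (@pgrad_cost_eta_near_clarke x i Xx).
pose s i := s2val (sP i).
have s_clarke i : clarke (hbar G i) (submxrow x i) (s i) by exact: (s2valP (sP i)).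
have s_close i : enorm (pgrad i (cost_eta G eta i) x - (s i + pgrad i (mbar G i) x))
    <= eta * `|Lhat i| by exact: (s2valP' (sP i)).
pose v := \mxrow_i (s i + pgrad i (mbar G i) x).
pose p := gamma^-1 *: (x - eproj X (x - gamma *: v)).
have p_in : G_clarke G gamma x p.
  by exists v => // i; exists (s i) => //; rewrite mxrowK.
have dist_le : eucl_dist 0 (G_clarke G gamma x) <= enorm p.
  apply: ge_inf; first by exists 0 => _ [y _ <-]; exact: enorm_ge0.
  by exists p => //; rewrite subr0.
have Fv : enorm (F_eta G eta x - v) ^+ 2 <= eta ^+ 2 * \sum_i Lhat i ^+ 2.
  rewrite /F_eta /v -mxrowB enorm_mxrow mulr_sumr; apply: ler_sum => i _.
  rewrite -[Lhat i ^+ 2]real_normK ?num_real// -exprMn ler_sqr ?nnegrE ?enorm_ge0//.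
  by rewrite mulr_ge0// ltW.
have pG : enorm (p - G_eta G eta gamma x) <= enorm (F_eta G eta x - v).
  rewrite /p /G_eta -scalerBr enormZ gtr0_norm ?invr_gt0// ler_pdivrMl//.
  rewrite opprB addrC addrA subrK enorm_distC.
  apply: le_trans (eproj_nonexpansive profiles_nonempty profiles_closed
    profiles_convex _ _) _.
  rewrite opprB addrC addrA subrK -scalerBr enormZ gtr0_norm//.
have pa : enorm p <= enorm (p - G_eta G eta gamma x) + enorm (G_eta G eta gamma x).
  by rewrite -{1}(subrK (G_eta G eta gamma x) p) enormD.
have dist0 := eucl_dist_ge0 0 (G_clarke G gamma x).
have Dle : eucl_dist 0 (G_clarke G gamma x) ^+ 2 <=
    (enorm (F_eta G eta x - v) + enorm (G_eta G eta gamma x)) ^+ 2.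
  rewrite ler_sqr ?nnegrE ?addr_ge0 ?enorm_ge0//.
  by apply: le_trans dist_le (le_trans pa _); rewrite lerD2r.
apply: le_trans Dle _; apply: le_trans (sqrrD_le2 _ _) _.
by rewrite lerD2r -mulrA ler_pM2l.
Qed.

Lemma iterate_in (A : scheme Pr q n) k w : X (x0 A) -> X (iterate G A eta k w).
Proof.
move=> X0; case: k => [//|k] i /=; rewrite mxrowK; apply: eproj_in.
- exact: strat_nonempty gameG i.
- exact: strat_closed gameG i.
Qed.

End game.

Theorem theorem4p3 (R : realType) (d : measure_display) (Om : measurableType d)
    (Pr : probability Om R) (N q : nat) (n : 'I_N -> nat)
    (G : game Pr q n) (A : scheme Pr q n)
    (L Lhat : 'I_N -> R) (eta Leta sigma_m eps : R) (pR : nat -> R) :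
  0 < eta ->
  lipschitz_game G L eta ->
  potential_game G ->
  smoothed_potential_game G eta Leta ->
  rs_rsg G A eta pR ->
  unbiased_sampling G A eta sigma_m ->
  (forall i, set_lipschitz (Lhat i) (enlarge (strat G i) eta)
               (clarke (hbar G i))) ->
  ('E_Pr[fun w =>
     (enorm (G_eta G eta (step A (out A w)) (output G A eta w)) ^+ 2)%R]
     <= (eps ^+ 2)%:E)%E ->
  ('E_Pr[fun w =>
     (eucl_dist 0 (G_clarke G (step A (out A w)) (output G A eta w)) ^+ 2)%R]
     <= (2 * eta ^+ 2 * \sum_i Lhat i ^+ 2 + 2 * eps ^+ 2)%:E)%E.
Proof.
move=> eta0 gameG _ _ schemeA _ hL; rewrite unlock => hE.
apply: le_trans (@lower_integral_affine _ _ _ Pr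
  (fun w => eucl_dist 0 (G_clarke G (step A (out A w)) (output G A eta w)) ^+ 2)
  (fun w => enorm (G_eta G eta (step A (out A w)) (output G A eta w)) ^+ 2)
  (2 * eta ^+ 2 * \sum_i Lhat i ^+ 2) _ _ _ _) _.
- apply: mulr_ge0; first by rewrite mulr_ge0 ?sqr_ge0.
  by apply: sumr_ge0 => i _; exact: sqr_ge0.
- by move=> w; exact: sqr_ge0.
- by move=> w; exact: sqr_ge0.
- move=> w; apply: (residual_bound eta0 gameG hL).
    exact: (iterate_in gameG _ _ (x0_in schemeA)).
  (* The index [out A w] may equal the horizon: the residual uses a stepsize one past the last
     update, and positivity is available there too. *)
  by apply: (step_gt0 schemeA); have /andP[] := out_range schemeA w.
rewrite [leRHS](_ : _ = (2 * eta ^+ 2 * \sum_i Lhat i ^+ 2)%:E +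
    2%:E * (eps ^+ 2)%:E)%E; last by rewrite -EFinM -EFinD.
by apply: leeD2l; apply: lee_wpmul2l.
Qed.
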